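(* Let $(V,\omega)$ be a real symplectic vector space of dimension $2n$, let $D\subset V$ be an $n$-dimensional subspace, and let $\mathrm{E}_D^{\mathrm{reg}}$ be the set of regular points of $\mathrm{E}_D$. For $L\in\mathrm{E}_D^{\mathrm{reg}}$ put $\ell_L:=L\cap D$ and $\ell'_L:=L\cap D^\perp$ (these are lines). Then: 1. A hyperplane $H$ of $L\in\mathrm{E}_D^{\mathrm{reg}}$ is characteristic for $\mathrm{E}_D^{\mathrm{reg}}$ at $L$ if and only if it contains $\ell_L$ or $\ell'_L$. Hence, if $\ell_L\neq\ell'_L$, there are two $(n-2)$-parametric families $H(t_1,\dots,t_{n-2})$ and $H'(t_1,\dots,t_{n-2})$ of characteristic hyperplanes in $L$, with $$\ell_L=\bigcap_{t_1,\dots,t_{n-2}}H(t_1,\dots,t_{n-2}),\qquad \ell'_L=\bigcap_{t_1,\dots,t_{n-2}}H'(t_1,\dots,t_{n-2});$$ if $\ell_L=\ell'_L$ these two families coincide. 2. The conformal metric of $\mathrm{E}_D^{\mathrm{reg}}$ is decomposable and is given by $\big(g_{\mathrm{E}_D^{\mathrm{reg}}}\big)_L=\ell_L\vee\ell'_L$, i.e. it is the class of $v\vee w$ up to a nonzero factor, where $\ell_L=\langle v\rangle$, $\ell'_L=\langle w\rangle$. 3. For any line $\ell\subset D$ there exists $L\in\mathrm{E}_D^{\mathrm{reg}}$ such that $\ell=\ell_L=L\cap D$. Hence $$D=\bigcup_{L\in\mathrm{E}_D^{\mathrm{reg}}}\ell_L,\qquad D^\perp=\bigcup_{L\in\mathrm{E}_D^{\mathrm{reg}}}\ell'_L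 .$$
   Context: $\mathcal{L}(V)$ is the smooth manifold of Lagrangian planes of $(V,\omega)$ ($n$-dimensional subspaces on which $\omega$ vanishes). For an $n$-dimensional subspace $D$, $D^\perp$ is its $\omega$-orthogonal complement and $\mathrm{E}_D=\{L\in\mathcal{L}(V)\mid L\cap D\neq0\}$. A point $L\in\mathrm{E}_D$ is singular if $\dim(L\cap D)\ge2$ and regular otherwise. (One has $\dim(L\cap D)=\dim(L\cap D^\perp)$ for $L\in\mathcal{L}(V)$.) If $D=\{\varrho_1=\dots=\varrho_n=0\}$ with $\varrho_i\in V^*$ and $\Omega_D=\varrho_1\wedge\cdots\wedge\varrho_n$, then locally $\mathrm{E}_D=\{F=0\}$ with $F(\widetilde L)=\Omega_D(w_1(\widetilde L),\dots,w_n(\widetilde L))$, where $w_i(\widetilde L)$ is a basis of $\widetilde L$ depending smoothly on $\widetilde L$; this $F$ is the defining function used below. For $\dot L\in T_L\mathcal{L}(V)$ let $\phi_t$ be any one-parameter subgroup of $Sp(V)$ with $\frac{d}{dt}\big|_{t=0}\phi_t(L)=\dot L$ and put $g^{\dot L}(v,w)=\omega\big(\frac{d}{dt}\big|_{t=0}\phi_t(v),w\big)$, $v,w\in L$; $\dot L\mapsto g^{\dot L}$ is a linear isomorphism $T_L\mathcal{L}(V)\to S^2(L^* )$. A covector $\rho\in T^*_L\mathcal{L}(V)$ defines $g_\rho\in S^2(L)$ by $g_\rho(\alpha,\beta)=\rho(\dot L)$, where $g^{\dot L}=\alpha\vee\beta$. Here $A\vee B=\tfrac12(A\otimes B+B\otimes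 A)$. The conformal metric of a hypersurface $\{F=0\}$ at a point $L$ is the class of $g_{(dF)_L}$ up to nonzero factors. For an isotropic subspace $U$, $U^{(1)}=\{\widetilde L\in\mathcal{L}(V)\mid\widetilde L\supseteq U\}$; a subspace $U\subset L$ is characteristic for $\{F=0\}$ at $L$ if $(dF)_L|_{T_LU^{(1)}}=0$. *)

(* Defs.v *)
From HB Require Import structures.
From mathcomp Require Import all_boot all_order all_algebra sesquilinear.
From mathcomp Require Import all_classical all_reals all_analysis.

Set Implicit Arguments.
Unset Strict Implicit.
Unset Printing Implicit Defensive.

Import Order.TTheory GRing.Theory Num.Theory.
Import numFieldNormedType.Exports.
Import VectorInternalTheory.

Local Open Scope classical_set_scope.
Local Open Scope ring_scope.

Section Smoothness.
Variable R : realType.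

Fixpoint Ck (U W : normedModType R) (k : nat) (f : U -> W) (O : set U) : Prop :=
  match k with
  | 0 => forall x, O x -> {for x, continuous f}
  | k'.+1 => (forall x, O x -> differentiable f x) /\
             forall v, Ck k' ('D_v f) O
  end.

Definition smooth_at (U W : normedModType R) (f : U -> W) (x : U) : Prop :=
  exists2 O, open_nbhs x O & forall k, Ck k f O.

(* A vectType carries no topology: curves in it are differentiated through its
   linear coordinates v2r, and the result does not depend on that choice. *)
Definition deriv0 (V : vectType R) (c : R -> V) : V :=
  r2v (derive1 (fun t : R => v2r (c t)) 0).

End Smoothness.

Section SymmetricProduct.
Variables (R : realType) (T : Type).

(* (A v B) = 1/2 (A (x) B + B (x) A), for linear forms A, B on T *)
Definition symprod (A B : T -> R) (x y : T) : R :=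
  2^-1 * (A x * B y + B x * A y).

Definition conformal_class (g : T -> T -> R) : set (T -> T -> R) :=
  [set h | exists2 c : R, c != 0 & forall x y, h x y = c * g x y].

End SymmetricProduct.

Section LagrangianGrassmannian.
Variables (R : realType) (V : vectType R) (n : nat).
Variable omega : {skew_symmetric V}.

Implicit Types (L D U H : {vspace V}).

Definition lagrangian : set {vspace V} :=
  [set L | \dim L = n /\ {in L &, forall u v, omega u v = 0}].

(* The manifold structure of the set of Lagrangian planes is the quotient one:
   the set of frames e of Lagrangian planes is a submanifold of V^n on which
   GL_n acts freely with e |-> <<codom e>> as quotient map.  Hence a function
   on Lagrangian planes is smooth when its lift to Lagrangian frames is locally
   the restriction of a smooth function on V^n, a property holds near L when
   its lift holds near every frame of L, and a smooth curve of planes is one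
   that locally is spanned by a smooth curve of frames. *)
Definition frame := {ffun 'I_n -> V}.

Definition near_plane (L : {vspace V}) (P : {vspace V} -> Prop) : Prop :=
  forall e : frame, <<codom e>>%VS = L ->
  \forall r \near v2r e,
    lagrangian <<codom (r2v r : frame)>>%VS ->
    P <<codom (r2v r : frame)>>%VS.

Definition smooth_fun (W : normedModType R) (f : {vspace V} -> W)
    (L : {vspace V}) : Prop :=
  forall e : frame, <<codom e>>%VS = L ->
  exists2 g : 'rV[R]_(dim frame) -> W, smooth_at g (v2r e) &
    \forall r \near v2r e,
      lagrangian <<codom (r2v r : frame)>>%VS ->
      f <<codom (r2v r : frame)>>%VS = g r.

(* gamma is, for small times, a smooth curve of Lagrangian planes lying in A *)
Definition smooth_curve (A : set {vspace V}) (gamma : R -> {vspace V}) : Prop :=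
  exists2 e : R -> frame, smooth_at (fun t : R => v2r (e t)) 0 &
    \forall t \near (0 : R),
      [/\ gamma t = <<codom (e t)>>%VS, lagrangian (gamma t) & A (gamma t)].

(* A tangent vector at L is the derivation f |-> (f o gamma)'(0) of a smooth
   curve gamma through L; it is set to 0 on functions that are not smooth at L,
   so that two tangent vectors are equal exactly when they agree on smooth
   functions. *)
Definition tangent := ({vspace V} -> R) -> R.

Definition velocity (L : {vspace V}) (gamma : R -> {vspace V}) : tangent :=
  fun f => if `[< smooth_fun f L >] then derive1 (fun t : R => f (gamma t)) 0 else 0.

(* T_L A, for a submanifold A of the manifold of Lagrangian planes *)
Definition tangent_space (A : set {vspace V}) (L : {vspace V}) : set tangent :=
  [set X | exists gamma,
     [/\ gamma 0 = L, smooth_curve A gamma & X = velocity L gamma]].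

Definition differential (F : {vspace V} -> R) : tangent -> R := fun X => X F.

Definition one_parameter_subgroup (phi : R -> 'End(V)) : Prop :=
  [/\ phi 0 = \1%VF,
      forall s t, phi (s + t) = (phi s \o phi t)%VF,
      forall t u v, omega (phi t u) (phi t v) = omega u v
    & forall t, smooth_at (fun s : R => v2r (phi s)) t].

(* g is the bilinear form g^X on L attached to the tangent vector X at L *)
Definition tangent_form (L : {vspace V}) (X : tangent)
    (g : subvs_of L -> subvs_of L -> R) : Prop :=
  exists phi, [/\ one_parameter_subgroup phi,
    velocity L (fun t => (phi t @: L)%VS) = X
  & forall v w, g v w = omega (deriv0 (fun t => phi t (vsval v))) (vsval w)].

Definition dual (L : {vspace V}) := 'Hom(subvs_of L, R^o).

(* g_rho(a, b) = rho(X), where X is the tangent vector with g^X = a v b *)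
Definition covector_form (L : {vspace V}) (rho : tangent -> R)
    (a b : dual L) : R :=
  rho (get [set X | tangent_space lagrangian L X /\
                    tangent_form X (symprod a b)]).

Definition conformal_metric (F : {vspace V} -> R) (L : {vspace V}) :
    set (dual L -> dual L -> R) :=
  conformal_class (covector_form (differential F)).

(* v v w in S^2(L), vectors of L being seen as linear forms on the dual of L *)
Definition vecprod (L : {vspace V}) (v w : subvs_of L) : dual L -> dual L -> R :=
  symprod (fun a : dual L => a v : R) (fun a : dual L => a w : R).

Definition decomposable (L : {vspace V}) (c : set (dual L -> dual L -> R)) : Prop :=
  exists v w : subvs_of L, [/\ v != 0, w != 0 & c = conformal_class (vecprod v w)].

Definition prolongation (U : {vspace V}) : set {vspace V} :=
  [set L | lagrangian L /\ (U <= L)%VS].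

Definition characteristic (F : {vspace V} -> R) (L U : {vspace V}) : Prop :=
  (U <= L)%VS /\
  forall X, tangent_space (prolongation U) L X -> differential F X = 0.

Definition hyperplane (L H : {vspace V}) : Prop :=
  (H <= L)%VS /\ (\dim H).+1 = \dim L.

Definition characteristic_family (F : {vspace V} -> R) (L l : {vspace V}) :
    set {vspace V} :=
  [set H | [/\ hyperplane L H, characteristic F L H & (l <= H)%VS]].

(* A k-parametric family of hyperplanes of L: the k parameters are given by
   k + 1 homogeneous coordinates t != 0, and H t is the zero set in L of
   t_0 a_0 + ... + t_k a_k, where the a_i are linearly independent on L; thus
   H t = H s if and only if t and s are proportional. *)
Definition parametric_family (L : {vspace V}) (k : nat)
    (H : 'rV[R]_k.+1 -> {vspace V}) : Prop :=
  exists a : 'I_k.+1 -> 'Hom(V, R^o),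
    (forall t : 'rV[R]_k.+1,
       {in L, forall v, (\sum_i t 0 i *: a i) v = 0} -> t = 0) /\
    forall t : 'rV[R]_k.+1, H t = (L :&: lker (\sum_i t 0 i *: a i)%R)%VS.

Definition E (D : {vspace V}) : set {vspace V} :=
  [set L | lagrangian L /\ (L :&: D)%VS != 0%VS].

Definition Ereg (D : {vspace V}) : set {vspace V} :=
  [set L | E D L /\ ~ (2 <= \dim (L :&: D))%N].

(* w is a basis of L', depending smoothly on L', for L' near L *)
Definition local_frame (L : {vspace V}) (w : {vspace V} -> frame) : Prop :=
  smooth_fun (fun L' => v2r (w L')) L /\
  near_plane L (fun L' => basis_of L' (codom (w L'))).

(* (rho_1 /\ ... /\ rho_n)(w_1, ..., w_n) *)
Definition wedge (rho : 'I_n -> 'Hom(V, R^o)) (w : frame) : R :=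
  \det (\matrix_(i < n, j < n) (rho i (w j) : R)).

Definition defining_function (D L : {vspace V}) (F : {vspace V} -> R) : Prop :=
  exists rho w, [/\ D = (\bigcap_(i < n) lker (rho i))%VS, local_frame L w
                  & F = fun L' => wedge rho (w L')].

End LagrangianGrassmannian.

Arguments conformal_metric {R V} n omega F L.

(* Main.v *)
Require Import Defs.
From HB Require Import structures.
From mathcomp Require Import all_boot all_order all_algebra sesquilinear.
From mathcomp Require Import zify.
From mathcomp Require Import all_classical all_reals all_analysis.

Set Implicit Arguments.
Unset Strict Implicit.
Unset Printing Implicit Defensive.

Import Order.TTheory GRing.Theory Num.Theory.
Import numFieldNormedType.Exports.

Local Open Scope classical_set_scope.
Local Open Scope ring_scope.

(** Let [L] be a regular point, and let [v] and [w] generate the lines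
    [l = L :&: D] and [l' = L :&: D'], where [D'] is the orthogonal of [D]; the
    latter is a line because it is the orthogonal of [L + D].

    The whole study of the hypersurface near [L] rests on one formula for the
    differential of a defining function [F]. If frames [e t] span a curve of
    Lagrangian planes through [L] and [A] is a linear map that sends each
    [e 0 j] to its derivative, then, for a suitable scaling of [v],
    [F] has derivative [omega w (A v)] along the curve
    ([velocity_defining_function]). Indeed, up to a continuous factor that does
    not vanish at [L] ([frame_ratio]), [F] is the determinant of the matrix of
    the [rho i (e t j)]. At [L] this matrix has corank one, and the
    derivative of the determinant at a matrix of corank one is
    [M' |-> y *m M' *m x], with [x] and [y] in the kernels on the right and on the
    left ([is_derive_det_corank1]). Here [x] gives the coordinates of [v], and
    [y] gives a combination of the [rho i] that vanishes on [L + D], which is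
    therefore [omega w] ([wedge_derivative]).

    For the velocity of a flow with generator [A] the attached quadratic form is
    [g v w = omega (A v) w], so that the conformal metric is the class of the
    symmetric product of [v] and [w]. This uses that every product of two
    linear forms on [L] is attached to some flow ([exists_tangent_form]): the
    shears [1 + t A], with [A] of square zero, suffice.

    If [H] contains [v] or [w] and the curve consists of planes containing [H],
    then [omega w (A v) = 0], because on [L] the form [omega u (A u')] is symmetric
    and vanishes as soon as one of its arguments is in [H]. If [H] contains
    neither of them, the shear along a vector [p] such that [omega p] has kernel
    [H] on [L] gives a curve on which the derivative of [F] is not zero
    ([characteristic_regular]). The characteristic hyperplanes containing [l] are
    then the kernels of the forms on [L] that vanish on [l], and they are
    parametrized by the coefficients of these forms in a basis.

    That every line of [D] is some [L :&: D] is shown by extending the line to a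
    Lagrangian plane one dimension at a time, keeping control of the
    intersections with [D] and with [D'] ([isotropic_extension]). *)

(* Unqualified, this name is that of a lemma on polynomials. *)
Local Notation deriv0 := Defs.deriv0.

(** * Functions of class C^k *)

Lemma near_eq_differentiable (R : numFieldType) (U W : normedModType R)
    (f g : U -> W) (x : U) :
  (\near x, f x = g x) -> differentiable f x -> differentiable g x.
Proof.
move=> fg df.
have E : g \o shift x = cst (g x) + 'd f x +o_ 0 id.
  apply/eqaddoP => _/posnumP[e].
  have N : \forall z \near 0, f (z + x) = g (z + x).
    rewrite (near_shift x); near=> z; rewrite /= sub0r subrK; by near: z.
  have /eqaddoP/(_ e%:num (gt0 e)) := diff_locally df.
  apply: filterS2 N.
  by move=> z /= fgz; rewrite !fctE /= fgz (nbhs_singleton fg).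
apply/diff_locallyP; rewrite (diff_unique _ E) //; last exact: diff_continuous.
by split=> //; exact: diff_continuous.
Unshelve. all: by end_near. Qed.

Section Ck.
Variables (R : realType) (U : normedModType R).

(** The formulas for the derivative of a sum or of a product hold on [O] only,
    while [Ck] speaks of total functions: this congruence carries the induction
    on [k] from one derivative to the next. *)
Lemma Ck_eq (W : normedModType R) k (f g : U -> W) (O : set U) :
  open O -> (forall x, O x -> f x = g x) -> Ck k f O -> Ck k g O.
Proof.
move=> oO; elim: k f g => [|k IH] f g fg /=.
  move=> cf x Ox; change (g y @[y --> x] --> g x).
  rewrite -fg //; apply: cvg_trans (cf x Ox).
  apply: near_eq_cvg; near=> y; apply: fg.
  by near: y; exact: open_nbhs_nbhs.
move=> [df Df]; split.
  move=> x Ox; apply: near_eq_differentiable (df x Ox); near=> y; apply: fg.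
  by near: y; exact: open_nbhs_nbhs.
move=> v; apply: IH (Df v) => x Ox; apply: near_eq_derive.
near=> y; apply: fg; by near: y; exact: open_nbhs_nbhs.
Unshelve. all: by end_near. Qed.

Lemma Ck_S (W : normedModType R) k (f : U -> W) (O : set U) :
  Ck k.+1 f O -> Ck k f O.
Proof.
elim: k f => [|k IH] f [df Df].
  by move=> x Ox; apply: differentiable_continuous; exact: df.
by split=> // v; apply: IH.
Qed.

Lemma Ck_cst (W : normedModType R) k (a : W) (O : set U) : open O ->
  Ck k (cst a : U -> W) O.
Proof.
move=> oO; elim: k a => [|k IH] a; first by move=> x _; exact: cst_continuous.
split=> [x _|v]; first exact: differentiable_cst.
by apply: (Ck_eq oO _ (IH 0)) => x Ox; rewrite derive_cst.
Qed.

Lemma Ck_add (W : normedModType R) k (f g : U -> W) (O : set U) : open O ->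
  Ck k f O -> Ck k g O -> Ck k (f + g) O.
Proof.
move=> oO; elim: k f g => [|k IH] f g.
  by move=> cf cg x Ox; apply: continuousD; [exact: cf|exact: cg].
move=> [df Df] [dg Dg]; split=> [x Ox|v].
  by apply: differentiableD; [exact: df|exact: dg].
apply: (Ck_eq oO _ (IH _ _ (Df v) (Dg v))) => x Ox.
by rewrite deriveD //; apply: diff_derivable; [exact: df|exact: dg].
Qed.

Lemma Ck_mul k (f g : U -> R) (O : set U) : open O ->
  Ck k f O -> Ck k g O -> Ck k (f * g) O.
Proof.
move=> oO; elim: k f g => [|k IH] f g.
  by move=> cf cg x Ox; apply: continuousM; [exact: cf|exact: cg].
move=> /[dup] /Ck_S Cf [df Df] /[dup] /Ck_S Cg [dg Dg]; split=> [x Ox|v].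
  by apply: differentiableM; [exact: df|exact: dg].
apply: (Ck_eq oO _ (Ck_add oO (IH _ _ Cf (Dg v)) (IH _ _ Cg (Df v)))) => x Ox.
by rewrite deriveM //; apply: diff_derivable; [exact: df|exact: dg].
Qed.

Lemma Ck_coord m k (f : U -> 'rV[R]_m) (O : set U) i : open O ->
  Ck k f O -> Ck k (fun x => f x 0 i) O.
Proof.
move=> oO; elim: k f => [|k IH] f.
  move=> cf x Ox.
  exact: (@continuous_comp _ _ _ f (fun M : 'rV_m => M 0 i) x (cf x Ox)
    (@coord_continuous _ _ _ _ _ _)).
move=> [df Df]; split=> [x Ox|v].
  exact: (@differentiable_comp _ _ _ _ f (fun M : 'rV_m => M 0 i) x (df x Ox)
    (@differentiable_coord _ _ _ _ _ _)).
apply: (Ck_eq oO _ (IH _ (Df v))) => x Ox.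
by rewrite derive_mx ?mxE //; exact/diff_derivable/df.
Qed.

End Ck.

Lemma is_diff_affine (R : realType) (W : normedModType R) (a b : W) (x : R) :
  is_diff x (fun t : R => a + t *: b) (0 + *:%R ^~ b).
Proof. exact: (@is_diffD _ _ _ (cst a) (fun t : R => t *: b)). Qed.

Lemma derive_affine (R : realType) (W : normedModType R) (a b : W) (x v : R) :
  'D_v (fun t : R => a + t *: b) x = v *: b.
Proof.
have [D E] := is_diff_affine a b x.
by rewrite deriveE // E fctE add0r.
Qed.

Lemma Ck_affine (R : realType) (W : normedModType R) k (a b : W) :
  Ck k (fun t : R => a + t *: b) setT.
Proof.
case: k => [|k].
  move=> x _; apply: continuousD; first exact: cst_continuous.
  exact: scalel_continuous.
split=> [x _|v]; first by have [] := is_diff_affine a b x.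
apply: (Ck_eq openT _ (@Ck_cst _ _ _ k (v *: b) setT openT)) => x _.
by rewrite derive_affine.
Qed.

(** * Polynomial expressions in coordinates *)

Section Polynomial.
Import VectorInternalTheory.

(** A determinant is a polynomial in the entries. The class [P] is arbitrary so
    that one statement serves for continuity at a point and for C^k functions. *)
Lemma det_closed (R : comNzRingType) T (P : (T -> R) -> Prop) n
    (M : T -> 'M[R]_n) :
  (forall a : R, P (fun=> a)) ->
  (forall f g, P f -> P g -> P (fun x => f x + g x)) ->
  (forall f g, P f -> P g -> P (fun x => f x * g x)) ->
  (forall i j, P (fun x => M x i j)) -> P (fun x => \det (M x)).
Proof.
move=> Pc Pa Pm PM; rewrite /determinant.
have ind I (r : seq I) op idx (F : I -> T -> R) :
   (forall f g, P f -> P g -> P (fun x => op (f x) (g x))) ->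
   (forall i, P (F i)) -> P (fun x => \big[op/idx]_(i <- r) F i x).
  move=> Pop PF; elim: r => [|i r IH].
    by rewrite (_ : (fun _ => _) = (fun=> idx)) //; apply/funext=> x; rewrite big_nil.
  rewrite (_ : (fun _ => _) = (fun x => op (F i x) (\big[op/idx]_(j <- r) F j x))).
    exact: Pop.
  by apply/funext=> x; rewrite big_cons.
apply: (ind) => // s; apply: (Pm (fun=> _)) => //.
exact: ind.
Qed.

Lemma coord_expansion (R : nzRingType) (V : vectType R) (l : {linear V -> R^o})
    (r : 'rV[R]_(dim V)) :
  l (r2v r) =
  \sum_i r 0 i * l (r2v (delta_mx 0 i)).
Proof.
rewrite {1}(row_sum_delta r) !linear_sum; apply: eq_bigr => i _.
by rewrite !linearZ.
Qed.

Lemma linear_closed (R : comNzRingType) (V : vectType R) T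
    (P : (T -> R) -> Prop) (l : {linear V -> R^o}) (c : T -> 'rV[R]_(dim V)) :
  (forall a : R, P (fun=> a)) ->
  (forall f g, P f -> P g -> P (fun x => f x + g x)) ->
  (forall f g, P f -> P g -> P (fun x => f x * g x)) ->
  (forall i, P (fun x => c x 0 i)) ->
  P (fun x => l (r2v (c x))).
Proof.
move=> Pc Pa Pm PM.
rewrite (_ : (fun _ => _) = (fun x => \sum_i
   c x 0 i * l (r2v (delta_mx 0 i)))); last first.
  by apply/funext=> x; exact: coord_expansion.
elim: (index_enum _) => [|i r IH].
  by under eq_fun do rewrite big_nil; exact: Pc.
by under eq_fun do rewrite big_cons; apply: Pa => //; apply: Pm => //; apply: Pc.
Qed.

End Polynomial.

(** * Derivatives of curves *)

Section Curves.
Variable R : realType.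
Import VectorInternalTheory.

Lemma deriv0_linear (V : vectType R) (l : {linear V -> R^o}) (c : R -> V) :
  derivable (fun t => v2r (c t)) 0 1 ->
  is_derive (0 : R) (1 : R) (fun t => l (c t) : R) (l (deriv0 c)).
Proof.
move=> dc; have /derivable_mxP dci := dc.
rewrite /deriv0 derive1E coord_expansion.
have -> : (fun t => l (c t)) = \sum_i (fun t => v2r (c t) 0 i *
    l (r2v (delta_mx 0 i))).
  by apply/funext=> t; rewrite fct_sumE -coord_expansion v2rK.
have D i : is_derive (0 : R) (1 : R) (fun t => v2r (c t) 0 i * l (r2v (delta_mx 0 i)) : R)
   ('D_1 (fun t => v2r (c t)) 0 0 i * l (r2v (delta_mx 0 i))).
  have Di : is_derive (0 : R) (1 : R) (fun t => v2r (c t) 0 i) ('D_1 (fun t => v2r (c t)) 0 0 i).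
    by split=> //; rewrite derive_mx // mxE.
  apply: is_derive_eq; rewrite scaler0 add0r.
  exact: mulrC.
exact: is_derive_sum.
Qed.

Lemma derivable_linear (V W : vectType R) (l : {linear V -> W}) (c : R -> V) :
  derivable (fun t => v2r (c t)) 0 1 ->
  derivable (fun t => v2r (l (c t))) 0 1 /\
  deriv0 (fun t => l (c t)) = l (deriv0 c).
Proof.
move=> dc.
have D i : is_derive (0 : R) (1 : R) (fun t => v2r (l (c t)) 0 i : R)
    (v2r (l (deriv0 c)) 0 i).
  pose g v : R^o := v2r (l v) 0 i.
  have gl : linear g by move=> a x y; rewrite /g !linearP !mxE.
  pose gM := GRing.isLinear.Build _ _ _ _ g gl.
  pose f : {linear V -> R^o} := HB.pack g gM.
  exact: (deriv0_linear f dc).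
have dl : derivable (fun t => v2r (l (c t))) 0 1.
  by apply/derivable_mxP => i j; rewrite ord1; have [] := D j.
split=> //; rewrite /deriv0 derive1E; apply: v2r_inj; rewrite r2vK derive_mx //.
by apply/rowP => i; rewrite mxE; apply: derive_val.
Qed.

(** As [c] vanishes at 0, the difference quotient of [b * c] is [b] times the one
    of [c]; hence [b] need not be differentiable. *)
Lemma is_derive_mul_at0 (b c : R -> R) (c' : R) :
  {for 0, continuous b} -> c 0 = 0 -> is_derive (0 : R) (1 : R) c c' ->
  is_derive (0 : R) (1 : R) (fun t => b t * c t) (b 0 * c').
Proof.
move=> cb c0 [dc <-].
have H : h^-1 *: (((fun t => b t * c t) \o shift 0) (h *: 1) - b 0 * c 0) @[h --> 0^']
   --> b 0 * 'D_1 c 0.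
  rewrite (_ : (fun h => _) = (fun h => b (h *: 1 + 0) *
      (h^-1 *: ((c \o shift 0) (h *: 1) - c 0)))); last first.
    by apply/funext=> h; rewrite /= c0 !(mulr0, subr0) scalerAr.
  apply: cvgM => //.
  apply: cvg_within_filter.
  under eq_cvg do rewrite addr0 -[_ *: 1]/(_ * _) mulr1.
  exact: cb.
by split; [apply: cvgP H|apply: cvg_lim].
Qed.

End Curves.

(** * The determinant near a matrix of corank one *)

Lemma pid_mx_cofactor (R : comNzRingType) m (j : 'I_m.+1) :
  cofactor (pid_mx m : 'M[R]_m.+1) ord_max j = (j == ord_max)%:R.
Proof.
rewrite /cofactor; case: eqVneq => [->|jmax].
  rewrite (_ : row' _ _ = 1%:M) ?det1 ?mulr1 /= ?addnn ?signr_odd.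
    by rewrite -signr_odd odd_double.
  apply/matrixP => a b; rewrite !mxE !lift_max -val_eqE /= andbC.
  by rewrite ltn_ord.
suff -> : \det (row' ord_max (col' j (pid_mx m : 'M[R]_m.+1))) = 0 by rewrite mulr0.
have /unlift_some[k kE _] : j != ord_max by [].
rewrite (expand_det_col _ k) big1 // => i _; rewrite !mxE -kE lift_max.
by rewrite /= (ltn_eqF (ltn_ord i)) mul0r.
Qed.

Section DetCorank1.
Variable R : realType.

(** In the expansion along the last row all the entries vanish at 0, so that only
    the values of the cofactors at 0 contribute, and all these are zero except
    the last. *)
Lemma is_derive_det_pid m (N : R -> 'M[R]_m.+1) (N' : 'M[R]_m.+1) :
  N 0 = pid_mx m ->
  (forall i j, is_derive (0 : R) (1 : R) (fun t => N t i j) (N' i j)) ->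
  is_derive (0 : R) (1 : R) (fun t => \det (N t)) (N' ord_max ord_max).
Proof.
move=> N0 dN.
have -> : (fun t => \det (N t)) =
    \sum_j (fun t => cofactor (N t) ord_max j * N t ord_max j).
  apply/funext => t; rewrite fct_sumE (expand_det_row _ ord_max).
  by apply: eq_bigr => j _; rewrite mulrC.
have -> : N' ord_max ord_max =
    \sum_j cofactor (N 0) ord_max j * N' ord_max j.
  rewrite (bigD1 ord_max) //= big1 => [|j jm].
    by rewrite N0 pid_mx_cofactor eqxx mul1r addr0.
  by rewrite N0 pid_mx_cofactor (negbTE jm) mul0r.
apply: is_derive_sum => j.
apply: (is_derive_mul_at0 (b := fun t => cofactor (N t) ord_max j) _ _ (dN _ _)).
  rewrite /cofactor; apply: continuousM; first exact: cst_continuous.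
  apply: (@det_closed R R (fun f => {for 0, continuous f})).
  - by move=> a; exact: cst_continuous.
  - by move=> f g; exact: continuousD.
  - by move=> f g; exact: continuousM.
  move=> a b.
  rewrite (_ : (fun t => _) = fun t => N t (lift ord_max a) (lift j b)); last first.
    by apply/funext => t; rewrite !mxE.
  have [/derivable1_diffP D _] := dN (lift ord_max a) (lift j b).
  exact: differentiable_continuous D.
by rewrite N0 !mxE ltnn andbF.
Qed.

(** Row and column operations reduce [M0] to [pid_mx m]. Through the inverse
    transition matrices its last row and column, which are zero, become
    generators of the two kernels of [M0]; the determinants of the transition
    matrices are absorbed in [x]. *)
Lemma is_derive_det_corank1 m (M0 : 'M[R]_m.+1) : \rank M0 = m ->
  exists (x : 'cV_m.+1) (y : 'rV_m.+1),
  [/\ x != 0, y != 0, M0 *m x = 0, y *m M0 = 0 &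
  forall (M : R -> 'M[R]_m.+1) (M' : 'M[R]_m.+1), M 0 = M0 ->
  (forall i j, is_derive (0 : R) (1 : R) (fun t => M t i j) (M' i j)) ->
  is_derive (0 : R) (1 : R) (fun t => \det (M t)) ((y *m M' *m x) 0 0)].
Proof.
move=> rk; set C := col_ebase M0; set W := row_ebase M0.
have uC : C \in unitmx := col_ebase_unit M0.
have uW : W \in unitmx := row_ebase_unit M0.
have M0E : M0 = C *m pid_mx m *m W by rewrite -{1}(mulmx_ebase M0) rk.
have d0 : \det C * \det W != 0.
  by rewrite mulf_neq0 // -unitfE -unitmxE.
exists ((\det C * \det W) *: col ord_max (invmx W)), (row ord_max (invmx C)).
have pidr : row ord_max (pid_mx m : 'M[R]_m.+1) = 0.
  by apply/rowP => i; rewrite !mxE ltnn andbF.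
have pidc : col ord_max (pid_mx m : 'M[R]_m.+1) = 0.
  by apply/colP => i; rewrite !mxE; case: eqP => //= ->; rewrite ltnn.
split.
- rewrite scaler_eq0 negb_or d0 /=; apply/eqP => /(congr1 (mulmx W)).
  rewrite mulmx0 colE mulmxA mulmxV // mul1mx => /matrixP/(_ ord_max 0).
  by rewrite !mxE eqxx => /eqP; rewrite oner_eq0.
- apply/eqP => /(congr1 (mulmx^~ C)).
  rewrite mul0mx -row_mul mulVmx // => /matrixP/(_ 0 ord_max).
  by rewrite !mxE eqxx => /eqP; rewrite oner_eq0.
- by rewrite -scalemxAr colE mulmxA M0E mulmxK // -mulmxA -colE pidc mulmx0 scaler0.
- by rewrite -row_mul M0E -mulmxA mulKmx // row_mul pidr mul0mx.
move=> M M' M0eq dM.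
pose N t := invmx C *m M t *m invmx W.
have E t : \det (M t) = \det C * \det W * \det (N t).
  rewrite mulrAC -!det_mulmx; congr (\det _).
  by rewrite /N !mulmxA mulmxV // mul1mx mulmxKV.
pose N' := invmx C *m M' *m invmx W.
have dN i j : is_derive (0 : R) (1 : R) (fun t => N t i j) (N' i j).
  have entry A : (invmx C *m A *m invmx W) i j =
      \sum_k \sum_l invmx W k j * invmx C i l * A l k.
    rewrite mxE; apply: eq_bigr => k _; rewrite mxE mulr_suml.
    by apply: eq_bigr => l _; rewrite mulrC mulrA.
  rewrite /N' entry; have -> : (fun t => N t i j) =
      \sum_k \sum_l (fun t => invmx W k j * invmx C i l * M t l k).
    apply/funext => t; rewrite /N entry fct_sumE.
    by apply: eq_bigr => k _; rewrite fct_sumE.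
  exact: is_derive_sum.
have N0 : N 0 = pid_mx m.
  by rewrite /N M0eq M0E -mulmxA mulmxK // mulKmx.
have D := is_derive_det_pid N0 dN.
under eq_fun do rewrite E.
have -> : (row ord_max (invmx C) *m M' *m (\det C * \det W *: col ord_max (invmx W))) 0 0
   = (\det C * \det W) *: N' ord_max ord_max.
  rewrite -scalemxAr mxE; congr (_ * _).
  by rewrite colE mulmxA -!row_mul -colE mxE [LHS]mxE.
exact: is_deriveZ.
Qed.

End DetCorank1.

(** * Symplectic linear algebra *)

Lemma line_of (K : fieldType) (V : vectType K) (U : {vspace V}) (v : V) :
  \dim U = 1%N -> v \in U -> v != 0 -> U = <[v]>%VS.
Proof.
by move=> dU vU v0; apply/esym/eqP; rewrite eqEdim -memvE vU dU dim_vline v0.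
Qed.

Section Symplectic.
Variables (R : realType) (V : vectType R) (n : nat) (omega : {skew_symmetric V}).
Hypotheses (omega_sympl : is_psymplectic omega) (dimV : \dim {:V} = (2 * n)%N).
Implicit Types (L D U : {vspace V}) (u v w p : V).
Local Notation orth := (orthov omega).

Lemma omegaC u v : omega u v = - omega v u.
Proof. by rewrite hermC expr1 mulN1r. Qed.

Lemma omega_alt u : omega u u = 0.
Proof.
have /eqP := omegaC u u; rewrite -addr_eq0 -mulr2n mulrn_eq0 /=.
by move/eqP.
Qed.

Lemma omega_nondeg u : (forall v, omega u v = 0) -> u = 0.
Proof.
move=> u0; have [/eqP nd _ _] := omega_sympl.
apply/eqP; rewrite -memv0 -nd; apply/mem_orthovP => v _; exact: u0.
Qed.

(** An injective linear map from [V] to its dual, which has the same dimension. *)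
Lemma riesz (f : {linear V -> R^o}) : exists p, forall u, omega p u = f u.
Proof.
have lin1 p : linear (fun u => omega p u : R^o).
  by move=> a x y; rewrite linearPr.
pose g p : 'Hom(V, R^o) := linfun (HB.pack (fun u => omega p u : R^o)
  (GRing.isLinear.Build _ _ _ _ (fun u => omega p u : R^o) (lin1 p)) : {linear V -> R^o}).
have gE p u : g p u = omega p u by rewrite lfunE.
have glin : linear g.
  move=> a p q; apply/lfunP => u; rewrite add_lfunE scale_lfunE !gE.
  by rewrite linearPl.
pose G : 'Hom(V, 'Hom(V, R^o)) := linfun (HB.pack g
  (GRing.isLinear.Build _ _ _ _ g glin) : {linear V -> 'Hom(V, R^o)}).
have GE p : G p = g p by rewrite lfunE.
have ker0 : lker G = 0%VS.
  apply/eqP; rewrite -subv0; apply/subvP => p; rewrite memv_ker GE => /eqP gp.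
  by rewrite memv0; apply/eqP/omega_nondeg => v; rewrite -gE gp zero_lfunE.
have : (linfun f \in limg G).
  suff -> : limg G = fullv by rewrite memvf.
  apply/eqP; rewrite eqEdim subvf /= limg_dim_eq; last by rewrite ker0 capv0.
  by rewrite !dimvf /= /dim /= muln1.
move=> /memv_imgP[p _ fE]; exists p => u.
by rewrite -gE -GE -fE lfunE.
Qed.

Lemma dim_orthov U : (\dim (orth U) + \dim U = \dim {:V})%N.
Proof.
set k := \dim U; pose X : k.-tuple V := vbasis U.
have fX : free X := basis_free (vbasisP U).
have glin : linear (fun p => \row_(i < k) omega p X`_i).
  by move=> a p q; apply/rowP => i; rewrite !mxE linearPl.
pose G : 'Hom(V, 'rV[R]_k) := linfun (HB.pack (fun p => \row_(i < k) omega p X`_i)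
  (GRing.isLinear.Build _ _ _ _ _ glin) : {linear V -> 'rV[R]_k}).
have GE p i : G p 0 i = omega p X`_i by rewrite lfunE mxE.
have kerG : lker G = orth U.
  apply/vspaceP => p; rewrite memv_ker; apply/eqP/mem_orthovP => [Gp v vU|pU].
    rewrite (coord_vbasis vU) linear_sumr big1 // => i _.
    by rewrite linearZr /= -GE Gp mxE mulr0.
  apply/rowP => i; rewrite GE mxE pU //.
  by apply: vbasis_mem; apply: mem_nth; rewrite size_tuple.
have imG : limg G = fullv.
  apply/eqP; rewrite eqEsubv subvf /=; apply/subvP => r _.
  have flin : linear (fun u => \sum_i r 0 i * coord X i u : R^o).
    move=> a u v; rewrite scaler_sumr -big_split; apply: eq_bigr => i _ /=.
    by rewrite linearP mulrDr mulrCA.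
  have [p pE] := riesz (HB.pack (fun u => \sum_i r 0 i * coord X i u : R^o)
    (GRing.isLinear.Build _ _ _ _ _ flin) : {linear V -> R^o}).
  apply/memv_imgP; exists p; first exact: memvf.
  apply/rowP => j; rewrite GE pE /= (bigD1 j) //= big1 => [|i ij].
    by rewrite coord_free // eqxx mulr1 addr0.
  by rewrite coord_free // eq_sym (negbTE ij) mulr0.
by rewrite -(limg_ker_dim G fullv) capfv kerG imG dimvf /dim /= mul1n.
Qed.

Lemma orthovK U : orth (orth U) = U.
Proof.
apply/esym/eqP; rewrite eqEdim orthov_sym subvv /=.
have := dim_orthov U; rewrite -(dim_orthov (orth U)) addnC => /addIn ->.
exact: leqnn.
Qed.

Lemma orthov_add U D : orth (U + D) = (orth U :&: orth D)%VS.
Proof.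
by apply/vspaceP => x; rewrite memv_cap !memvE !(orthov_sym _ <[x]>) orthoDv.
Qed.

Lemma isotropicP U : reflect {in U &, forall u v, omega u v = 0} (U <= orth U)%VS.
Proof. exact: orthovP. Qed.

Lemma orthov_lagrangian L : lagrangian n omega L -> orth L = L.
Proof.
move=> [dL iL]; apply/esym/eqP; rewrite eqEdim (introT (isotropicP L) iL) /=.
by rewrite -(leq_add2r (\dim L)) dim_orthov dimV dL mul2n addnn.
Qed.

Lemma dim_regular L D : Ereg n omega D L -> \dim (L :&: D) = 1%N.
Proof.
move=> [[_ LD0] LD1].
by apply/eqP; rewrite eqn_leq lt0n dimv_eq0 LD0 andbT leqNgt; apply/negP.
Qed.

Lemma dim_orthov_half D : \dim D = n -> \dim (orth D) = n.
Proof.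
by move=> dD; have := dim_orthov D; rewrite dimV dD mul2n -addnn => /addIn.
Qed.

(** For Lagrangian [L] the orthogonal of [L + D] is [L :&: orth D]. *)
Lemma dim_cap_orthov L D : lagrangian n omega L -> \dim D = n ->
  \dim (L :&: orth D) = \dim (L :&: D).
Proof.
move=> lL dD; have [dL _] := lL.
rewrite -{1}(orthov_lagrangian lL) -orthov_add.
have := dim_orthov (L + D); have := dimv_sum_cap L D.
by rewrite dimV dL dD; lia.
Qed.

(** Since [U] lies in [orth U], the space [U + D :&: orth U] consists of the vectors
    of [orth U] that belong to [U + D], that is, those whose adjunction to [U]
    could enlarge [U :&: D]. *)
Lemma dim_add_cap_orthov U D : (U <= orth U)%VS -> \dim D = n ->
  (\dim (U + D :&: orth U) + \dim (U :&: D) = n + \dim (U :&: orth D))%N.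
Proof.
move=> iU dD.
have := dimv_sum_cap U (D :&: orth U).
have -> : (U :&: (D :&: orth U) = U :&: D)%VS.
  by rewrite capvA capvC capvA (capv_idPr iU).
move=> ->; have : \dim (D :&: orth U) = \dim (orth (orth D + U)).
  by rewrite orthov_add orthovK.
have := dim_orthov (orth D + U); have := dimv_sum_cap (orth D) U.
rewrite dim_orthov_half // dimV capvC; lia.
Qed.

Lemma proper_union U A B : ~~ (U <= A)%VS -> ~~ (U <= B)%VS ->
  exists u, [/\ u \in U, u \notin A & u \notin B].
Proof.
move=> /subvPn[x xU xA] /subvPn[y yU yB].
have [xB|] := boolP (x \in B); last by exists x.
have [yA|] := boolP (y \in A); last by exists y.
exists (x + y); split; first exact: memvD.
  by apply: contra xA => /(memvB)/(_ yA); rewrite addrK.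
by apply: contra yB => /(memvB)/(_ xB); rewrite addrC addrA addNr add0r.
Qed.

Lemma cap_add_line U D u : u \in orth U -> u \notin (U + D :&: orth U)%VS ->
  (U <= orth U)%VS -> ((U + <[u]>) :&: D = U :&: D)%VS.
Proof.
move=> uU' uA iU; apply/eqP; rewrite eqEsubv (capvS (addvSl _ _) (subvv _)) andbT.
apply/subvP => x; rewrite !memv_cap => /andP[/memv_addP[a aU [_ /vlineP[c ->] ->]] xD].
rewrite xD andbT; have [->|c0] := eqVneq c 0; first by rewrite scale0r addr0.
case/negP: uA; have -> : u = - (c^-1 *: a) + c^-1 *: (a + c *: u).
  by rewrite scalerDr addrA addNr add0r scalerA mulVf // scale1r.
apply: memv_add; first by rewrite memvN memvZ.
by rewrite memv_cap !memvZ //= memvD ?memvZ //; apply: (subvP iU).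
Qed.

Lemma isotropic_add_line U u : (U <= orth U)%VS -> u \in orth U ->
  (U + <[u]> <= orth (U + <[u]>))%VS.
Proof.
move=> iU uU; rewrite orthoDv !(orthov_sym _ _ (_ + _)%VS) !orthoDv iU.
by rewrite orthov11 omega_alt eqxx andbT (orthov_sym _ U) -memvE uU.
Qed.

(** A Lagrangian plane through [l] is built one dimension at a time, by vectors of
    [orth U] outside of [U + D]. By [dim_add_cap_orthov] there are such vectors as
    long as [U :&: orth D] has dimension at most 1, so this bound is part of the
    induction. It is preserved for free when [U :&: orth D] is 0; when it is a
    line, the new vector must also avoid [U + orth D], which is possible because
    a space is not the union of two proper subspaces. *)
Lemma isotropic_extension D l k : \dim D = n -> \dim l = 1%N -> (l <= D)%VS ->
  (k < n)%N ->
  exists U, [/\ \dim U = k.+1, (U <= orth U)%VS, (l <= U)%VS,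
    \dim (U :&: D) = 1%N & (\dim (U :&: orth D) <= 1)%N].
Proof.
move=> dD dl lD; elim: k => [|k IH] kn.
  exists l; split=> //; last 2 first.
  - by rewrite (capv_idPl lD).
  - by rewrite -dl dimvS // capvSl.
  rewrite (line_of dl (memv_pick l)); last by rewrite vpick0 -dimv_eq0 dl.
  by rewrite orthov11 omega_alt.
have [U [dU iU lU dUD dUD']] := IH (ltnW kn).
have nsub B : (\dim B <= n)%N -> ~~ (orth U <= B)%VS.
  move=> dB; apply/negP => /dimvS dB'.
  by have := dim_orthov U; rewrite dimV dU; lia.
have nA : ~~ (orth U <= U + D :&: orth U)%VS.
  by apply: nsub; have := dim_add_cap_orthov iU dD; lia.
pose good u := u \in orth U /\ u \notin (U + D :&: orth U)%VS.
have [u [uU uA] uD'] : exists2 u, good u &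
    (\dim ((U + <[u]>) :&: orth D) <= 1)%N.
  have [d0|d0] := posnP (\dim (U :&: orth D)).
    have [u uU uA] := subvPn nA; exists u => //.
    pose W := ((U + <[u]>) :&: orth D)%VS.
    have := dimv_sum_cap W U.
    have : (\dim (W :&: U) <= \dim (U :&: orth D))%N.
      by rewrite capvC dimvS // capvS // capvSr.
    have : (\dim (W + U) <= \dim U + 1)%N.
      apply: leq_trans (_ : \dim (U + <[u]>) <= _)%N.
        by rewrite dimvS // subv_add capvSl addvSl.
      by rewrite (leq_trans (dimv_add_leqif _ _)) // leq_add2l dim_vline leq_b1.
    rewrite -/W; lia.
  have [|u [uU uA uA']] := @proper_union (orth U) (U + D :&: orth U)%VS
      (U + orth D :&: orth U)%VS nA.
    apply: nsub; have := dim_add_cap_orthov iU (dim_orthov_half dD).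
    by rewrite orthovK; lia.
  by exists u => //; rewrite cap_add_line.
exists (U + <[u]>)%VS; split=> //.
- have uNU : u \notin U by apply: contra uA; apply: subvP; exact: addvSl.
  rewrite dimv_disjoint_sum ?dU ?dim_vline.
    by rewrite (_ : u != 0) ?addn1 //; apply: contraNneq uNU => ->; rewrite mem0v.
  apply/eqP; rewrite -subv0; apply/subvP => x; rewrite memv_cap.
  move=> /andP[xU /vlineP[c xE]]; rewrite memv0 xE scaler_eq0.
  have [//|c0] := eqVneq c 0; case/negP: uNU.
  by rewrite -[u]scale1r -(mulVf c0) -scalerA -xE memvZ.
- exact: isotropic_add_line.
- exact: subv_trans lU (addvSl _ _).
- by rewrite cap_add_line.
Qed.

Lemma exists_lagrangian_cap D l : \dim D = n -> \dim l = 1%N -> (l <= D)%VS ->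
  exists2 L, Ereg n omega D L & l = (L :&: D)%VS.
Proof.
move=> dD dl lD.
have n0 : (0 < n)%N by rewrite -dD -dl; exact: dimvS.
have nE : n = n.-1.+1 by rewrite prednK.
have [|U [dU iU lU dUD _]] := @isotropic_extension D l n.-1 dD dl lD.
  by rewrite prednK.
exists U; last by apply/eqP; rewrite eqEdim subv_cap lU lD dUD dl.
split; last by rewrite dUD.
split; first by split; [rewrite dU -nE|exact/isotropicP].
by rewrite -dimv_eq0 dUD.
Qed.

End Symplectic.

(** * Symplectic flows and shears *)

Section Flows.
Variables (R : realType) (V : vectType R) (n : nat) (omega : {skew_symmetric V}).
Hypothesis omega_sympl : is_psymplectic omega.
Implicit Types (L : {vspace V}) (u v : V).
Import VectorInternalTheory.

Lemma affine_curve_smooth (W : vectType R) (a b : W) t :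
  smooth_at (fun s : R => v2r (a + s *: b)) t.
Proof.
exists setT; first by split; [exact: openT|].
move=> k; rewrite (_ : (fun s => _) = (fun s => v2r a + s *: v2r b)).
  exact: Ck_affine.
by apply/funext => s; rewrite linearD linearZ.
Qed.

Lemma smooth_at_derivable (W : normedModType R) (c : R -> W) t :
  smooth_at c t -> derivable c t 1.
Proof.
by move=> [A [_ At] /(_ 1%N)[dc _]]; apply: diff_derivable; exact: dc.
Qed.

Lemma deriv0_affine (W : vectType R) (a b : W) :
  deriv0 (fun s : R => a + s *: b) = b.
Proof.
rewrite /deriv0 (_ : (fun s => _) = (fun s => v2r a + s *: v2r b)).
  by rewrite derive1E derive_affine scale1r v2rK.
by apply/funext => s; rewrite linearD linearZ.
Qed.

Lemma deriv0_eval (phi : R -> 'End(V)) v :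
  smooth_at (fun t => v2r (phi t)) 0 ->
  deriv0 (fun t => phi t v) = deriv0 phi v.
Proof.
move=> sp.
have el : linear (fun f : 'End(V) => f v).
  by move=> a f g; rewrite add_lfunE scale_lfunE.
pose ev : {linear 'End(V) -> V} := HB.pack (fun f : 'End(V) => f v)
  (GRing.isLinear.Build _ _ _ _ _ el).
by have [_ ->] := derivable_linear ev (smooth_at_derivable sp).
Qed.

Definition push (phi : 'End(V)) (e : frame V n) : frame V n := [ffun j => phi (e j)].

Lemma span_push phi (e : frame V n) :
  <<codom (push phi e)>>%VS = (phi @: <<codom e>>)%VS.
Proof.
rewrite limg_span; suff -> : codom (push phi e) = map phi (codom e) by [].
rewrite /codom /image_mem -[RHS]map_comp; apply: eq_map => j.
by rewrite /= /push ffunE.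
Qed.

Lemma lagrangian_limg (phi : 'End(V)) L :
  (forall u v, omega (phi u) (phi v) = omega u v) ->
  lagrangian n omega L -> lagrangian n omega (phi @: L)%VS.
Proof.
move=> sphi [dL iL]; split.
  rewrite limg_dim_eq //; apply/eqP; rewrite -subv0; apply/subvP => u.
  rewrite memv_cap memv_ker => /andP[_ /eqP pu]; rewrite memv0; apply/eqP.
  by apply: (omega_nondeg omega_sympl) => v; rewrite -sphi pu linear0l.
by move=> _ _ /memv_imgP[u uL ->] /memv_imgP[v vL ->]; rewrite sphi iL.
Qed.

Lemma push_derivable (phi : R -> 'End(V)) (e : frame V n) :
  smooth_at (fun t => v2r (phi t)) 0 ->
  derivable (fun t => v2r (push (phi t) e)) 0 1 /\
  deriv0 (fun t => push (phi t) e) = push (deriv0 phi) e.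
Proof.
move=> sp.
have el : linear (fun f : 'End(V) => push f e).
  by move=> a f g; apply/ffunP => j; rewrite !ffunE add_lfunE scale_lfunE.
pose ev : {linear 'End(V) -> frame V n} := HB.pack (fun f : 'End(V) => push f e)
  (GRing.isLinear.Build _ _ _ _ _ el).
exact: (derivable_linear ev (smooth_at_derivable sp)).
Qed.

Section Shear.
Variables (p q : V).
Hypothesis pq0 : omega p q = 0.

(** The element of the symplectic Lie algebra that corresponds to the quadratic
    form given by the symmetric product of [omega p] and [omega q]. *)
Definition shear_fun u := 2^-1 *: (omega p u *: q + omega q u *: p).

Lemma shear_linear : linear shear_fun.
Proof.
move=> a u v; rewrite /shear_fun.
have E r : omega r (a *: u + v) = a * omega r u + omega r v by rewrite linearPr.
rewrite !E [a *: (_ *: _)]scalerA (mulrC a 2^-1) -[(2^-1 * a) *: _]scalerA.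
rewrite -[in RHS]scalerDr; congr (_ *: _).
by rewrite scalerDr !scalerA !scalerDl addrACA.
Qed.

HB.instance Definition _ := GRing.isLinear.Build _ _ _ _ shear_fun shear_linear.

Definition shear : 'End(V) := linfun shear_fun.

Lemma omega_shear u v :
  omega (shear u) v = symprod (fun x => omega p x) (fun x => omega q x) u v.
Proof. by rewrite lfunE /= linearZl linearDl !linearZl. Qed.

Lemma shear_shear u : shear (shear u) = 0.
Proof.
have qp0 : omega q p = 0 by rewrite omegaC pq0 oppr0.
have z r : omega r p = 0 -> omega r q = 0 -> omega r (shear u) = 0.
  move=> rp rq; rewrite lfunE /= /shear_fun linearZr /= linearDr !linearZr /=.
  by rewrite rp rq !mulr0 addr0 mulr0.
rewrite [shear (shear u)]lfunE /= /shear_fun !z ?omega_alt //.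
by rewrite !scale0r addr0 scaler0.
Qed.

(** The exponential of [t *: shear], since the shear squares to zero when
    [omega p q] is zero. *)
Definition shear_flow (t : R) : 'End(V) := (\1 + t *: shear)%VF.

Lemma shear_flowE t u : shear_flow t u = u + t *: shear u.
Proof. by rewrite add_lfunE id_lfunE scale_lfunE. Qed.

Lemma shear_flow_subgroup : one_parameter_subgroup omega shear_flow.
Proof.
have sk u v : omega (shear u) v = - omega u (shear v).
  rewrite [in RHS]omegaC opprK !omega_shear /symprod addrC.
  by rewrite (mulrC (omega q u)) (mulrC (omega p u)).
split.
- by rewrite /shear_flow scale0r addr0.
- move=> s t; apply/lfunP => u; rewrite comp_lfunE !shear_flowE.
  by rewrite linearD linearZ /= shear_shear scaler0 addr0 -addrA scalerDl [s *: _ + _]addrC.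
- move=> t u v; rewrite !shear_flowE linearDl !linearDr !linearZl !linearZr /=.
  have -> : omega (shear u) (shear v) = 0.
    by rewrite sk shear_shear linear0r oppr0.
  by rewrite !mulr0 addr0 sk mulrN addrK.
- move=> t; exact: affine_curve_smooth.
Qed.

Lemma deriv0_shear_flow : deriv0 shear_flow = shear.
Proof. exact: deriv0_affine. Qed.

End Shear.
End Flows.

(** * Frames and wedges of linear forms *)

Section Frames.
Variables (R : realType) (V : vectType R) (n : nat).
Implicit Types (rho : 'I_n -> 'Hom(V, R^o)) (e f : frame V n) (L : {vspace V}).

Lemma codom_mktuple e : codom e = mktuple e :> seq V.
Proof. by rewrite /codom /image_mem /= -val_ord_tuple. Qed.

Lemma nth_codom e (i : 'I_n) : (codom e)`_i = e i.
Proof. by rewrite codom_mktuple nth_mktuple. Qed.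

Lemma mem_span_codom e j : e j \in <<codom e>>%VS.
Proof. by apply: memv_span; exact: codom_f. Qed.

Lemma span_codom_sum e v : v \in <<codom e>>%VS ->
  exists c : 'I_n -> R, v = \sum_j c j *: e j.
Proof.
rewrite codom_mktuple => /coord_span ->.
exists (fun j => coord (mktuple e) j v).
by apply: eq_bigr => j _; rewrite nth_mktuple.
Qed.

Lemma frame_free e L : \dim L = n -> <<codom e>>%VS = L -> free (codom e).
Proof. by move=> dL eL; rewrite /free size_codom card_ord eL; apply/eqP. Qed.

Lemma exists_frame L : \dim L = n -> exists e, <<codom e>>%VS = L.
Proof.
move=> dL; exists [ffun j : 'I_n => (vbasis L)`_j].
rewrite -[RHS](span_basis (vbasisP L)); congr span.
apply: (@eq_from_nth _ 0); rewrite size_codom card_ord ?size_tuple ?dL // => i lti.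
by rewrite (nth_codom _ (Ordinal lti)) ffunE.
Qed.

Lemma exists_hom_frame e f : free (codom e) -> exists A : 'End(V), f = push A e.
Proof.
move=> fe; have [g gE] := linear_of_free (codom e) (codom f).
have E : map g (codom e) = codom f by apply: gE => //; rewrite !size_codom.
exists (linfun g); apply/ffunP => j; rewrite ffunE lfunE -(nth_codom e) -(nth_codom f).
by rewrite -E (nth_map 0) // size_codom card_ord.
Qed.

Lemma wedge_span e f : (forall j, f j \in <<codom e>>%VS) ->
  exists B : 'M[R]_n, forall rho, wedge rho f = wedge rho e * \det B.
Proof.
move=> fe; have [c cE] : exists c : 'I_n -> 'I_n -> R, forall j, f j = \sum_k c j k *: e k.
  have /choice[c] := fun j => span_codom_sum (fe j).
  by exists c.
exists (\matrix_(k, j) c j k) => rho; rewrite /wedge -det_mulmx; congr (\det _).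
apply/matrixP => i j; rewrite !mxE cE linear_sum; apply: eq_bigr => k _.
by rewrite !mxE linearZ /= mulrC.
Qed.

(** Passing from [e] to [f] multiplies all wedges of [n] forms by the same
    determinant. *)
Lemma wedge_swap rho sigma e f : (forall j, f j \in <<codom e>>%VS) ->
  wedge rho f * wedge sigma e = wedge sigma f * wedge rho e.
Proof.
move=> /wedge_span[B BE]; rewrite !BE [LHS]mulrAC [RHS]mulrAC.
by congr (_ * _); exact: mulrC.
Qed.

Definition dual_frame e : 'I_n -> 'Hom(V, R^o) :=
  fun i => linfun (coord (mktuple e) i : V -> R^o).

Lemma wedge_dual_frame e : free (codom e) -> wedge (dual_frame e) e = 1.
Proof.
rewrite codom_mktuple => fe; rewrite /wedge -[RHS](det1 R n); congr (\det _).
apply/matrixP => i j; rewrite !mxE lfunE /=.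
by rewrite -(nth_mktuple e 0 j) coord_free // eq_sym.
Qed.

Lemma wedge_dual_frame_neq0 e f : free (codom e) -> <<codom e>>%VS = <<codom f>>%VS ->
  wedge (dual_frame e) f != 0.
Proof.
move=> fe ef; have [B BE] : exists B : 'M[R]_n, forall rho, wedge rho e = wedge rho f * \det B.
  by apply: wedge_span => j; rewrite -ef; exact: mem_span_codom.
apply/eqP => w0; have := BE (dual_frame e); rewrite w0 mul0r wedge_dual_frame //.
by move/eqP; rewrite oner_eq0.
Qed.

Definition entry (a : 'Hom(V, R^o)) (j : 'I_n) (e : frame V n) : R^o := a (e j).

Lemma entry_linear a j : linear (entry a j).
Proof. by move=> c e f; rewrite /entry !ffunE linearP. Qed.

HB.instance Definition _ a j := GRing.isLinear.Build _ _ _ _ (entry a j) (entry_linear a j).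

Import VectorInternalTheory.

Lemma wedge_closed T (P : (T -> R) -> Prop) rho (c : T -> 'rV[R]_(dim (frame V n))) :
  (forall a : R, P (fun=> a)) ->
  (forall h k, P h -> P k -> P (fun x => h x + k x)) ->
  (forall h k, P h -> P k -> P (fun x => h x * k x)) ->
  (forall i, P (fun x => c x 0 i)) ->
  P (fun x => wedge rho (r2v (c x))).
Proof.
move=> Pc Pa Pm PM; apply: det_closed => // i j.
have := @linear_closed R (frame V n) T P (entry (rho i) j) c Pc Pa Pm PM.
by congr P; apply/funext => x; rewrite mxE.
Qed.

End Frames.

(** * The differential of a defining function *)

Section DefiningFunction.
Variables (R : realType) (V : vectType R) (n : nat) (omega : {skew_symmetric V}).
Implicit Types (L D U : {vspace V}) (u v w p : V).
Import VectorInternalTheory.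

(** A velocity is zero on the functions that are not smooth, so the differential
    of a defining function says something only once this is known. *)
Lemma smooth_fun_wedge (rho : 'I_n -> 'Hom(V, R^o)) (w : {vspace V} -> frame V n) L :
  local_frame omega L w -> smooth_fun n omega (fun L' => wedge rho (w L')) L.
Proof.
move=> [sw _] e eL; have [g [A [oA Ae] sg] gw] := sw e eL.
exists (fun r => wedge rho (r2v (g r))).
  exists A => // k.
  apply: (wedge_closed (P := fun h => Ck k h A)).
  - by move=> a; exact: Ck_cst.
  - by move=> h h'; exact: Ck_add.
  - by move=> h h'; exact: Ck_mul.
  - by move=> i; exact: Ck_coord.
by apply: filterS gw => r gw /gw <-; rewrite v2rK.
Qed.

(** The common kernel has codimension [n], so the [n] forms are independent. *)
Lemma ker_forms_onto D (rho : 'I_n -> 'Hom(V, R^o)) :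
  \dim {:V} = (2 * n)%N -> \dim D = n -> D = (\bigcap_(i < n) lker (rho i))%VS ->
  forall r : 'I_n -> R, exists v, forall i, rho i v = r i.
Proof.
move=> dV dD DE r.
have gl : linear (fun v => \row_i (rho i v : R)).
  by move=> a u v; apply/rowP => i; rewrite !mxE linearP.
pose G : 'Hom(V, 'rV[R]_n) := linfun (HB.pack (fun v => \row_i (rho i v : R))
  (GRing.isLinear.Build _ _ _ _ _ gl) : {linear V -> 'rV[R]_n}).
have GE v i : G v 0 i = rho i v by rewrite lfunE mxE.
have kerG : lker G = D.
  rewrite DE; apply/vspaceP => v; rewrite memv_ker; apply/eqP/idP => [Gv|vD].
    by rewrite memvE; apply/subv_bigcapP => i _; rewrite -memvE memv_ker -GE Gv mxE.
  apply/rowP => i; rewrite GE mxE; apply/eqP; rewrite -memv_ker.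
  by apply: subvP v vD; exact: bigcapv_inf.
have : \row_i r i \in limg G.
  suff -> : limg G = fullv by rewrite memvf.
  apply/eqP; rewrite eqEdim subvf /= dimvf /dim /= mul1n.
  have := limg_ker_dim G fullv; rewrite capfv kerG dD dV mul2n -addnn.
  by move/addnI => ->.
move=> /memv_imgP[v _ vE]; exists v => i.
by rewrite -GE -vE mxE.
Qed.

End DefiningFunction.

Section Derivative.
Variables (R : realType) (V : vectType R) (m : nat) (omega : {skew_symmetric V}).
Local Notation n := m.+1.
Hypotheses (omega_sympl : is_psymplectic omega) (dimV : \dim {:V} = (2 * n)%N).
Implicit Types (L D U : {vspace V}) (u v w p : V).
Import VectorInternalTheory.

(** A column in the kernel of this matrix is the column of coordinates, in [e], of
    a vector of [L :&: D]. *)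
Lemma rank_regular L D (rho : 'I_n -> 'Hom(V, R^o)) (e : frame V n) :
  \dim L = n -> <<codom e>>%VS = L -> \dim (L :&: D) = 1%N ->
  D = (\bigcap_(i < n) lker (rho i))%VS ->
  \rank (\matrix_(i < n, j < n) (rho i (e j) : R)) = m.
Proof.
move=> dL eL dLD DE; set M := matrix_of_fun _ _.
have fe : free (mktuple e) by rewrite -codom_mktuple; exact: frame_free eL.
pose comb (x : 'rV[R]_n) := \sum_j x 0 j *: e j.
have combL x : comb x \in L.
  by apply: memv_suml => j _; rewrite memvZ // -eL mem_span_codom.
have combD x : (comb x \in D) = (x *m M^T == 0).
  have E i : rho i (comb x) = (x *m M^T) 0 i.
    rewrite linear_sum mxE; apply: eq_bigr => j _.
    by rewrite !mxE linearZ.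
  rewrite DE; apply/idP/eqP => [xD|xM].
    apply/rowP => i; rewrite -E mxE; apply/eqP; rewrite -memv_ker.
    by apply: subvP _ xD; exact: bigcapv_inf.
  by rewrite memvE; apply/subv_bigcapP => i _; rewrite -memvE memv_ker E xM mxE.
have comb_inj x y : comb x = comb y -> x = y.
  move=> xy; apply/rowP => j.
  have cE z : comb z = \sum_j z 0 j *: (mktuple e)`_j.
    by apply: eq_bigr => k _; rewrite nth_mktuple.
  by rewrite -(coord_sum_free _ _ fe) -cE xy cE coord_sum_free.
have [v vLD v0] : exists2 v, v \in (L :&: D)%VS & v != 0.
  by exists (vpick (L :&: D)); rewrite ?memv_pick // vpick0 -dimv_eq0 dLD.
have LDE := line_of dLD vLD v0.
have [x xE] : exists x, v = comb x.
  move: vLD; rewrite memv_cap -eL => /andP[/span_codom_sum[c ->] _].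
  by exists (\row_j c j); apply: eq_bigr => j _; rewrite mxE.
have x0 : x != 0.
  apply: contraNneq v0 => x0; rewrite xE x0 /comb big1 // => j _.
  by rewrite mxE scale0r.
have kx : (kermx M^T :=: x)%MS.
  apply/eqmxP/andP; split.
    apply/rV_subP => y /sub_kermxP/eqP; rewrite -combD => yD.
    have : comb y \in <[v]>%VS by rewrite -LDE memv_cap combL.
    move=> /vlineP[k yE]; apply/sub_rVP; exists k; apply: comb_inj.
    rewrite yE xE scaler_sumr; apply: eq_bigr => j _.
    by rewrite mxE scalerA.
  apply/sub_kermxP/eqP; rewrite -combD -xE.
  by move: vLD; rewrite memv_cap => /andP[].
have := mxrank_ker M^T; rewrite kx rank_rV x0 mxrank_tr.
have := rank_leq_row M; lia.
Qed.

Lemma entry_push (a : 'Hom(V, R^o)) (A : 'End(V)) j (e : frame V n) :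
  entry a j (push A e) = a (A (e j)).
Proof. by rewrite /entry /push ffunE. Qed.

(** The matrix of the [rho i (e0 j)] has corank one. Its right kernel consists of
    the coordinates of the vectors of [L :&: D]. A row [y] in its left kernel makes
    the form [\sum_i y i * rho i] vanish on [L] and on [D]; this form is therefore
    [omega w] with [w] orthogonal to both. *)
Lemma wedge_derivative L D (rho : 'I_n -> 'Hom(V, R^o)) (e0 : frame V n) :
  lagrangian n omega L -> \dim D = n -> \dim (L :&: D) = 1%N ->
  D = (\bigcap_(i < n) lker (rho i))%VS -> <<codom e0>>%VS = L ->
  exists v w, [/\ v \in (L :&: D)%VS, v != 0, w \in (L :&: orthov omega D)%VS, w != 0 &
    forall (e : R -> frame V n) (A : 'End(V)),
      e 0 = e0 -> derivable (fun t => v2r (e t)) 0 1 -> deriv0 e = push A e0 ->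
      wedge rho e0 = 0 /\
      is_derive (0 : R) (1 : R) (fun t => wedge rho (e t)) (omega w (A v))].
Proof.
move=> lL dD dLD DE eL; have [dL iL] := lL.
set M0 := \matrix_(i < n, j < n) (rho i (e0 j) : R).
have [x [y [x0 y0 Mx yM dM]]] := is_derive_det_corank1 (rank_regular dL eL dLD DE).
have fe0 : free (codom e0) by exact: frame_free eL.
pose v0 := \sum_j x j 0 *: e0 j.
have [w0 w0E] : exists w0, forall u, omega w0 u = \sum_i y 0 i * rho i u.
  have fl : linear (fun u => \sum_i y 0 i * rho i u : R^o).
    move=> a u v; rewrite scaler_sumr -big_split; apply: eq_bigr => i _ /=.
    by rewrite linearP mulrDr mulrCA.
  exact: (riesz omega_sympl (HB.pack (fun u => \sum_i y 0 i * rho i u : R^o)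
    (GRing.isLinear.Build _ _ _ _ _ fl) : {linear V -> R^o})).
exists v0, w0; split.
- rewrite memv_cap; apply/andP; split.
    by apply: memv_suml => j _; rewrite memvZ // -eL mem_span_codom.
  rewrite DE memvE; apply/subv_bigcapP => i _; rewrite -memvE memv_ker.
  have -> : rho i v0 = \sum_j M0 i j * x j 0 :> R.
    by rewrite /v0 linear_sum; apply: eq_bigr => j _; rewrite mxE linearZ /= mulrC.
  by move/colP/(_ i): Mx; rewrite !mxE => ->.
- apply: contra x0 => /eqP v00; apply/eqP/colP => j; rewrite mxE.
  have fe : free (mktuple e0) by rewrite -codom_mktuple.
  have v0E : v0 = \sum_j x j 0 *: (mktuple e0)`_j.
    by apply: eq_bigr => k _; rewrite nth_mktuple.
  by rewrite -(coord_sum_free (fun j => x j 0) j fe) -v0E v00 linear0.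
- rewrite memv_cap; apply/andP; split.
    rewrite -(orthov_lagrangian omega_sympl dimV lL).
    apply/mem_orthovP => u; rewrite -eL => /span_codom_sum[c ->].
    rewrite linear_sumr big1 // => j _; rewrite linearZr /= w0E.
    move/rowP/(_ j): yM; rewrite !mxE => yM; rewrite -[RHS](mulr0 (c j)) -[in RHS]yM.
    by congr (_ * _); apply: eq_bigr => i _; rewrite !mxE.
  apply/mem_orthovP => d inD; rewrite w0E big1 // => i _.
  have : d \in lker (rho i) by apply: subvP d inD; rewrite DE; exact: bigcapv_inf.
  by rewrite memv_ker => /eqP ->; rewrite mulr0.
- apply: contra y0 => /eqP w00; apply/eqP/rowP => i; rewrite mxE.
  have [d dE] := ker_forms_onto dimV dD DE (fun k => (k == i)%:R).
  have := w0E d; rewrite w00 linear0l (bigD1 i) //= dE eqxx mulr1 big1.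
    by rewrite addr0.
  by move=> k ki; rewrite dE (negbTE ki) mulr0.
move=> e A ee0 de eA; split.
  apply/eqP; apply/negPn; rewrite -unitfE -unitmxE; apply: contra x0 => uM.
  by rewrite -(mulKmx uM x) Mx mulmx0.
pose M' := \matrix_(i < n, j < n) (rho i (A (e0 j)) : R).
have -> : omega w0 (A v0) = (y *m M' *m x) 0 0.
  rewrite w0E -mulmxA mxE; apply: eq_bigr => i _; congr (_ * _).
  rewrite mxE /v0 !linear_sum; apply: eq_bigr => j _.
  by rewrite mxE !linearZ /= mulrC.
apply: dM; first by rewrite ee0.
move=> i j; have := deriv0_linear (entry (rho i) j) de.
have -> : (fun t => (\matrix_(i, j) (rho i (e t j) : R)) i j) = (fun t => entry (rho i) j (e t)).
  by apply/funext => t; rewrite mxE.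
by rewrite eA mxE /= entry_push.
Qed.

(** The factor [b] is a ratio of values of one wedge, that of the coordinate forms
    of [e0]. In this form its continuity is clear, without any study of the
    coordinates of [w (gamma t)] in the moving frame [e t]. *)
Lemma frame_ratio (w : {vspace V} -> frame V n) L (e0 : frame V n) (e : R -> frame V n)
    (gamma : R -> {vspace V}) :
  lagrangian n omega L -> local_frame omega L w -> <<codom e0>>%VS = L -> e 0 = e0 ->
  derivable (fun t => v2r (e t)) 0 1 ->
  (\forall t \near (0 : R), gamma t = <<codom (e t)>>%VS /\ lagrangian n omega (gamma t)) ->
  exists b : R -> R, [/\ {for 0, continuous b}, b 0 = wedge (dual_frame e0) (w L) &
    forall rho, \forall t \near (0 : R), b t * wedge rho (e t) = wedge rho (w (gamma t))].
Proof.
move=> [dL iL] lw eL ee0 de gE.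
have fe0 : free (codom e0) by exact: frame_free eL.
have [sw _] := lw; have [g [B [oB Be] sg] gw] := sw e0 eL.
set sigma := dual_frame e0.
have e00 : wedge sigma (e 0) = 1 by rewrite ee0; exact: wedge_dual_frame.
have ce : {for 0, continuous (fun t => v2r (e t))}.
  by apply: differentiable_continuous; apply/derivable1_diffP.
have ce0 : v2r (e t) @[t --> (0 : R)] --> v2r e0 by rewrite -ee0; exact: ce.
have cont_wedge (c : R -> 'rV[R]_(dim (frame V n))) :
    {for 0, continuous c} -> {for 0, continuous (fun t => wedge sigma (r2v (c t)))}.
  move=> cc; apply: (wedge_closed (P := fun h => {for 0, continuous h})).
  - by move=> a; exact: cst_continuous.
  - by move=> h k; exact: continuousD.
  - by move=> h k; exact: continuousM.
  - move=> i; apply: (@continuous_comp _ _ _ c (fun M : 'rV_(dim (frame V n)) => M 0 i) 0 cc).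
    exact: coord_continuous.
have nearw : \forall t \near (0 : R), lagrangian n omega <<codom (e t)>>%VS ->
    v2r (w <<codom (e t)>>%VS) = g (v2r (e t)) /\
    basis_of <<codom (e t)>>%VS (codom (w <<codom (e t)>>%VS)).
  have [_ /(_ e0 eL) nb] := lw.
  apply: (@filterS _ (nbhs (0 : R)) _ _ _ _ (ce0 _ (filterI gw nb))) => t [p1 p2].
  by rewrite !v2rK in p1 p2; move=> lt; split; [exact: p1|exact: p2].
pose num t := wedge sigma (r2v (g (v2r (e t)))).
pose den t := wedge sigma (r2v (v2r (e t))).
have cnum : {for 0, continuous num}.
  apply: (cont_wedge (fun t => g (v2r (e t)))).
  apply: (@continuous_comp _ _ _ (fun t => v2r (e t)) g 0 ce).
  by have := sg 0%N; apply; rewrite ee0.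
have cden : {for 0, continuous den} by exact: cont_wedge.
have den00 : den 0 = 1 by rewrite /den v2rK.
exists (fun t => num t / den t); split.
- apply: continuousM => //; apply: continuousV => //.
  by rewrite den00 oner_eq0.
- rewrite den00 divr1 /num ee0.
  have := nbhs_singleton gw; rewrite v2rK eL => <- //.
  by rewrite v2rK.
move=> rho.
have den0 : \forall t \near (0 : R), den t != 0.
  have : nbhs (den 0) [set r | r != 0] by apply: open_nbhs_nbhs; split;
    [exact: open_neq|rewrite /= den00 oner_eq0].
  exact: cden.
move: nearw gE den0; apply: filterS3 => t nw [gt lt] d0.
rewrite gt in lt *; have [wg wb] := nw lt.
rewrite mulrAC; apply: (canLR (mulfK d0)).
rewrite /num -wg /den !v2rK -wedge_swap // => j.
by have := mem_span_codom (w <<codom (e t)>>%VS) j; rewrite (span_basis wb).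
Qed.

(** Near 0 the function [F] is [wedge rho (e t)] times the continuous factor of
    [frame_ratio], whose value at 0 depends only on [e0] and is nonzero; since
    [wedge rho e0] is zero, that value, absorbed in [v], is all that the
    derivative retains of the factor. *)
Lemma velocity_defining_function L D F (e0 : frame V n) :
  Ereg n omega D L -> \dim D = n -> defining_function n omega D L F ->
  <<codom e0>>%VS = L ->
  exists v w, [/\ v \in (L :&: D)%VS, v != 0, w \in (L :&: orthov omega D)%VS, w != 0 &
    forall (gamma : R -> {vspace V}) (e : R -> frame V n) (A : 'End(V)),
      e 0 = e0 -> derivable (fun t => v2r (e t)) 0 1 ->
      (\forall t \near (0 : R), gamma t = <<codom (e t)>>%VS /\ lagrangian n omega (gamma t)) ->
      deriv0 e = push A e0 ->
      velocity n omega L gamma F = omega w (A v)].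
Proof.
move=> LD dD [rho [w [DE lw FE]]] eL; have dLD := dim_regular LD.
have [[lL _] _] := LD.
have [v0 [w0 [v0LD v00 w0LD w00 dw]]] := wedge_derivative lL dD dLD DE eL.
have fe0 : free (codom e0) by case: lL => dL _; exact: frame_free eL.
pose kappa := wedge (dual_frame e0) (w L).
have kappa0 : kappa != 0.
  have wL : basis_of L (codom (w L)).
    by have [_ /(_ e0 eL) /nbhs_singleton] := lw; rewrite v2rK eL; exact.
  by apply: wedge_dual_frame_neq0 => //; rewrite eL (span_basis wL).
exists (kappa *: v0), w0; split=> //; first exact: memvZ.
  by rewrite scaler_eq0 negb_or kappa0.
move=> gamma e A ee0 de gE eA.
rewrite /velocity asboolT; last by rewrite FE; exact: smooth_fun_wedge.
rewrite derive1E.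
have [b [cb b0 bE]] := frame_ratio lL lw eL ee0 de gE.
have [rho0 dr] := dw e A ee0 de eA.
suff [_ ->] : is_derive (0 : R) (1 : R) (fun t => F (gamma t)) (omega w0 (A (kappa *: v0))) by [].
rewrite FE; apply: near_eq_is_derive (bE rho) _.
have -> : omega w0 (A (kappa *: v0)) = b 0 * omega w0 (A v0).
  by rewrite b0 linearZ /= linearZr.
by apply: is_derive_mul_at0 => //; rewrite ee0.
Qed.

End Derivative.

(** * Hyperplanes containing a line *)

Section LinearForms.
Variables (R : realType) (V : vectType R).
Implicit Types (L l H : {vspace V}) (a : 'Hom(V, R^o)).

(** The [a i] are the coordinates in a basis [f] of a complement of [l] in [L]. *)
Lemma forms_cutting_out_line L l k : \dim L = k.+2 -> \dim l = 1%N -> (l <= L)%VS ->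
  exists (a : 'I_k.+1 -> 'Hom(V, R^o)) (f : 'I_k.+1 -> V),
  [/\ forall i, f i \in L, forall i j, a i (f j) = (i == j)%:R,
      forall v, v \in l -> forall i, a i v = 0 &
      forall v, v \in L -> v - \sum_i a i v *: f i \in l].
Proof.
move=> dL dl lL; pose K := (L :\: l)%VS.
have dK : \dim K = k.+1.
  by have := dimv_cap_compl L l; rewrite (capv_idPr lL) dl dL add1n => -[].
have [f fK] := exists_frame dK; have ff := frame_free dK fK.
have Kl : (K :&: l = 0)%VS by exact: capv_diff.
have LKl : (K + l)%VS = L by rewrite addv_diff; exact/addv_idPl.
have fiK i : f i \in K by rewrite -fK mem_span_codom.
have afE i v : (dual_frame f i \o daddv_pi K l)%VF v = coord (mktuple f) i (daddv_pi K l v).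
  by rewrite comp_lfunE /= lfunE.
have piE v : v \in L -> v - daddv_pi K l v \in l.
  move=> vL; rewrite -{1}(daddv_pi_add (w := v) Kl) ?LKl // addrC addrA addNr add0r.
  exact: memv_pi.
exists (fun i => (dual_frame f i \o daddv_pi K l)%VF), f; split.
- by move=> i; rewrite -LKl; apply: subvP (fiK i); exact: addvSl.
- have fM : free (mktuple f) by rewrite -codom_mktuple.
  by move=> i j; rewrite afE daddv_pi_id // -(nth_mktuple f 0 j) coord_free // eq_sym.
- move=> v vl i; rewrite afE.
  suff -> : daddv_pi K l v = 0 by rewrite linear0.
  apply/eqP; rewrite -memv0 -Kl memv_cap memv_pi /=.
  have vL : v \in L by apply: (subvP lL).
  by have := memvB vl (piE v vL); rewrite opprB addrC subrK.
- move=> v /piE; suff -> : \sum_i (dual_frame f i \o daddv_pi K l)%VF v *: f i = daddv_pi K l v by [].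
  have : daddv_pi K l v \in <<mktuple f>>%VS by rewrite -codom_mktuple fK memv_pi.
  move=> /coord_span ->; apply: eq_bigr => i _; rewrite afE.
  by rewrite nth_mktuple.
Qed.

Lemma hyperplane_ker L a : ~~ (L <= lker a)%VS -> hyperplane L (L :&: lker a).
Proof.
move=> La; split; first exact: capvSl.
rewrite -(limg_ker_dim a L) -addn1; congr addn.
apply/esym/eqP; rewrite eqn_leq lt0n dimv_eq0 -lkerE La andbT.
by have := dimvS (subvf (a @: L)); rewrite dimvf.
Qed.

End LinearForms.

(** * Curves of Lagrangian planes *)

Section Derivations.
Variables (R : realType) (V : vectType R) (n : nat) (omega : {skew_symmetric V}).
Implicit Types (L D U : {vspace V}) (u v w p : V).
Import VectorInternalTheory.

Lemma is_derive_omega (c d : R -> V) :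
  derivable (fun t => v2r (c t)) 0 1 -> derivable (fun t => v2r (d t)) 0 1 ->
  is_derive (0 : R) (1 : R) (fun t => omega (c t) (d t) : R)
    (omega (deriv0 c) (d 0) + omega (c 0) (deriv0 d)).
Proof.
move=> dc dd.
pose B i : V := r2v (delta_mx 0 i).
have lin1 u : linear (fun v => omega u v : R^o) by move=> a x y; rewrite linearPr.
have linl u : linear (fun v => omega v u : R^o) by move=> a x y; rewrite linearPl.
pose om1 u : {linear V -> R^o} := HB.pack (fun v => omega u v : R^o)
  (GRing.isLinear.Build _ _ _ _ _ (lin1 u)).
pose oml u : {linear V -> R^o} := HB.pack (fun v => omega v u : R^o)
  (GRing.isLinear.Build _ _ _ _ _ (linl u)).
have exp u v : omega u v = \sum_i v2r u 0 i * omega (B i) v.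
  by rewrite -{1}[u]v2rK; exact: (coord_expansion (oml v)).
have -> : (fun t => omega (c t) (d t)) =
    \sum_i (fun t => v2r (c t) 0 i * omega (B i) (d t)).
  by apply/funext => t; rewrite fct_sumE exp.
have Dc i : is_derive (0 : R) (1 : R) (fun t => v2r (c t) 0 i) (v2r (deriv0 c) 0 i).
  split; first by have /derivable_mxP := dc; apply.
  by rewrite /deriv0 r2vK derive1E (derive_mx dc) mxE.
have Dd i : is_derive (0 : R) (1 : R) (fun t => omega (B i) (d t) : R) (omega (B i) (deriv0 d)).
  exact: (deriv0_linear (om1 (B i)) dd).
rewrite (exp (deriv0 c)) (exp (c 0)) -big_split.
apply: is_derive_sum => i /=.
apply: is_derive_eq; rewrite addrC; congr (_ + _).
exact: mulrC.
Qed.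

Definition comb (x : 'I_n -> R) (e : frame V n) : V := \sum_j x j *: e j.

Lemma comb_linear x : linear (comb x).
Proof.
move=> a e f; rewrite /comb scaler_sumr -big_split; apply: eq_bigr => j _ /=.
by rewrite !ffunE scalerDr !scalerA mulrC.
Qed.

HB.instance Definition _ x := GRing.isLinear.Build _ _ _ _ (comb x) (comb_linear x).

Lemma comb_push x (A : 'End(V)) e : comb x (push A e) = A (comb x e).
Proof. by rewrite /comb linear_sum; apply: eq_bigr => j _; rewrite ffunE linearZ. Qed.

Lemma comb_mem x e : comb x e \in <<codom e>>%VS.
Proof. by apply: memv_suml => j _; rewrite memvZ // mem_span_codom. Qed.

Variables (e : R -> frame V n) (A : 'End(V)).
Hypotheses (de : derivable (fun t => v2r (e t)) 0 1) (eA : deriv0 e = push A (e 0)).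

(** The form [omega] vanishes on any two combinations of the [e t j] with constant
    coefficients; differentiate this. *)
Lemma lagrangian_curve_symmetric :
  (\forall t \near (0 : R), lagrangian n omega <<codom (e t)>>%VS) ->
  {in <<codom (e 0)>>%VS &, forall u v, omega u (A v) = omega v (A u)}.
Proof.
move=> le u v /span_codom_sum[x ->] /span_codom_sum[y ->].
have [dx Ex] := derivable_linear (comb x) de.
have [dy Ey] := derivable_linear (comb y) de.
have [_] := is_derive_omega dx dy.
rewrite Ex Ey eA /= !comb_push => E.
have : \forall t \near (0 : R), omega (comb x (e t)) (comb y (e t)) = cst 0 t.
  by apply: filterS le => t [_]; apply; exact: comb_mem.
move/(near_eq_derive (1 : R)); rewrite derive_cst E => /eqP.
by rewrite addrC addr_eq0 -omegaC => /eqP.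
Qed.

(** Here [omega h] vanishes on the combinations of the [e t j]. *)
Lemma fixed_vector_orthogonal h :
  (\forall t \near (0 : R), lagrangian n omega <<codom (e t)>>%VS /\
     h \in <<codom (e t)>>%VS) ->
  {in <<codom (e 0)>>%VS, forall u, omega h (A u) = 0}.
Proof.
move=> le u /span_codom_sum[x ->].
have [dx Ex] := derivable_linear (comb x) de.
have lh : linear (fun v => omega h v : R^o) by move=> a y z; rewrite linearPr.
have [_] := deriv0_linear (HB.pack (fun v => omega h v : R^o)
  (GRing.isLinear.Build _ _ _ _ _ lh) : {linear V -> R^o}) dx.
rewrite Ex eA /= comb_push => <-.
have : \forall t \near (0 : R), omega h (comb x (e t)) = cst 0 t.
  by apply: filterS le => t [[_ it] ht]; apply: it => //; exact: comb_mem.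
by move/(near_eq_derive (1 : R)); rewrite derive_cst.
Qed.

End Derivations.

(** * The hypersurface at a regular point *)

Section Hypersurface.
Variables (R : realType) (V : vectType R) (m : nat) (omega : {skew_symmetric V}).
Local Notation n := m.+1.
Hypotheses (omega_sympl : is_psymplectic omega) (dimV : \dim {:V} = (2 * n)%N).
Implicit Types (D U : {vspace V}).
Import VectorInternalTheory.

(** The orthogonal of [H] has dimension [n + 1], so it contains some [p] outside of
    [L]. As [L] is its own orthogonal, [omega p] is not zero on all of [L]. *)
Lemma exists_hyperplane_form L H : lagrangian n omega L -> hyperplane L H ->
  exists p, forall u, u \in L -> (omega p u == 0) = (u \in H).
Proof.
move=> lL [HL dH]; have [dL iL] := lL.
have : ~~ (orthov omega H <= L)%VS.
  apply/negP => /dimvS; have := dim_orthov omega_sympl H.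
  by rewrite dimV dL; rewrite dL in dH; lia.
move=> /subvPn[p pH pL]; exists p => u uL; apply/eqP/idP => [pu|uH]; last first.
  by have /mem_orthovP := pH; apply.
apply: contraR pL => uH.
have LE : L = (H + <[u]>)%VS.
  apply/esym/eqP; rewrite eqEdim subv_add HL -memvE uL /= -dH.
  rewrite ltnNge; apply: contra uH => dle.
  have : (H == (H + <[u]>)%VS) by rewrite eqEdim addvSl.
  by move/eqP->; rewrite memvE addvSr.
rewrite -(orthov_lagrangian omega_sympl dimV lL) [in orthov _ L]LE.
by rewrite orthov_add memv_cap pH mem_orthov1 pu eqxx.
Qed.

(** A linear form on [L] that vanishes on [l] is a combination of the forms of
    [forms_cutting_out_line], with its values on the [f i] as coefficients. *)
Lemma exists_characteristic_family L F l k : lagrangian n omega L -> (k.+2 = n)%N ->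
  \dim l = 1%N -> (l <= L)%VS ->
  (forall H, hyperplane L H -> (l <= H)%VS -> characteristic n omega F L H) ->
  exists H : 'rV[R]_k.+1 -> {vspace V},
    [/\ parametric_family L H, H @` [set t | t != 0] = characteristic_family n omega F L l &
     [set` l] = \bigcap_(t in [set t | t != 0]) [set` H t]].
Proof.
move=> lagL kn dl lL charl; have [dL iL] := lagL.
have dL2 : \dim L = k.+2 by rewrite dL.
have [a [f [fL af al aL]]] := forms_cutting_out_line dL2 dl lL.
pose g (t : 'rV[R]_k.+1) := \sum_i t 0 i *: a i.
have gE t v : g t v = \sum_i t 0 i * a i v.
  by rewrite sum_lfunE; apply: eq_bigr => i _; rewrite scale_lfunE.
have gf t j : g t (f j) = t 0 j.
  rewrite gE (bigD1 j) //= af eqxx mulr1 big1 ?addr0 // => i ij.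
  by rewrite af (negbTE ij) mulr0.
have g0 t : {in L, forall v, g t v = 0} -> t = 0.
  by move=> tL; apply/rowP => j; rewrite -gf tL // mxE.
have lg t : (l <= L :&: lker (g t))%VS.
  rewrite subv_cap lL; apply/subvP => v vl; rewrite memv_ker gE big1 // => i _.
  by rewrite al // mulr0.
exists (fun t => L :&: lker (g t))%VS; split.
- by exists a.
- apply/seteqP; split=> [_ [t t0 <-]|H [hH cH lH]].
    have hH : hyperplane L (L :&: lker (g t)).
      apply: hyperplane_ker; apply: contra t0 => /subvP gt; apply/eqP/g0 => v vL.
      by apply/eqP; rewrite -memv_ker gt.
    by split=> //; exact: charl.
  have [p pE] := exists_hyperplane_form lagL hH.
  pose t := \row_i omega p (f i).
  have pg v : v \in L -> omega p v = g t v.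
    move=> vL; have : v - \sum_i a i v *: f i \in H by exact: (subvP lH _ (aL v vL)).
    rewrite -pE; last by rewrite memvB // memv_suml // => i _; rewrite memvZ.
    rewrite linearBr linear_sumr subr_eq0 => /eqP ->; rewrite gE.
    by apply: eq_bigr => i _; rewrite linearZr mxE mulrC.
  exists t.
    apply/eqP => t0; have [_ dH] := hH.
    have : (L <= H)%VS.
      apply/subvP => v vL; rewrite -pE // pg // t0 gE big1 // => i _.
      by rewrite mxE mul0r.
    by move/dimvS; rewrite -dH ltnn.
  apply/vspaceP => v; rewrite memv_cap memv_ker.
  have [vL|vL] := boolP (v \in L); first by rewrite -pg // pE.
  apply/esym/negbTE; apply: contra vL; apply: subvP; by case: hH.
- apply/seteqP; split=> [v /= vl t _ | v vH] /=; first exact: (subvP (lg t)).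
  have dlt i : v \in L /\ a i v = 0.
    have := vH (delta_mx 0 i); rewrite /= memv_cap memv_ker.
    have -> : g (delta_mx 0 i) v = a i v.
      rewrite gE (bigD1 i) //= mxE !eqxx mul1r big1 ?addr0 // => j ji.
      by rewrite mxE (negbTE ji) mul0r.
    move=> /(_ _)/andP[].
      by apply/eqP => /matrixP/(_ 0 i)/eqP; rewrite !mxE !eqxx oner_eq0.
    by move=> -> /eqP.
  have [vL _] := dlt 0; have := aL v vL.
  by rewrite big1 ?subr0 // => i _; have [_ ->] := dlt i; rewrite scale0r.
Qed.

Lemma flow_curve L (phi : R -> 'End(V)) (e0 : frame V n) :
  lagrangian n omega L -> <<codom e0>>%VS = L -> one_parameter_subgroup omega phi ->
  [/\ push (phi 0) e0 = e0, derivable (fun t => v2r (push (phi t) e0)) 0 1,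
    \forall t \near (0 : R), (phi t @: L)%VS = <<codom (push (phi t) e0)>>%VS /\
      lagrangian n omega (phi t @: L)%VS &
    deriv0 (fun t => push (phi t) e0) = push (deriv0 phi) e0].
Proof.
move=> lL eL [phi0 _ sphi smphi].
have [dp Dp] := push_derivable e0 (smphi 0).
split=> //; first by apply/ffunP => j; rewrite ffunE phi0 id_lfunE.
by near=> t; rewrite span_push eL; split=> //; exact: lagrangian_limg.
Unshelve. all: by end_near. Qed.

Lemma shear_flow_smooth_curve (A : set {vspace V}) L (p q : V) (e0 : frame V n) :
  lagrangian n omega L -> <<codom e0>>%VS = L -> omega p q = 0 ->
  (forall t, A (shear_flow omega p q t @: L)%VS) ->
  smooth_curve n omega A (fun t => (shear_flow omega p q t @: L)%VS).
Proof.
move=> lL eL pq AL; exists (fun t => push (shear_flow omega p q t) e0).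
  rewrite (_ : (fun t => _) = (fun t : R => v2r (e0 + t *: push (shear omega p q) e0))).
    exact: affine_curve_smooth.
  by apply/funext => t; congr v2r; apply/ffunP => j; rewrite !ffunE shear_flowE.
have [_ _ near_L _] := flow_curve lL eL (shear_flow_subgroup pq).
by apply: filterS near_L => t [E lt]; split.
Qed.

(** Represent [a] and [b] by [omega p] and [omega q] and take the flow of the shear
    of [p] and [q]; for it to be a flow, [omega p q] must be zero. *)
Lemma exists_tangent_form L (a b : dual L) : lagrangian n omega L ->
  exists X, tangent_space n omega (lagrangian n omega) L X /\
    tangent_form n omega X (symprod (fun x => a x : R) (fun x => b x : R)).
Proof.
move=> lL; have [e0 eL] := exists_frame lL.1.
have rep (c : dual L) : exists p, forall u : subvs_of L, omega p (vsval u) = c u.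
  have [p pE] := riesz omega_sympl (c \o vsproj L).
  by exists p => u; rewrite pE /= vsvalK.
have [p [q [pE qE pq]]] : exists p q, [/\ forall u, omega p (vsval u) = a u,
    forall u, omega q (vsval u) = b u & omega p q = 0].
  have [->|/lfunPn[u au]] := eqVneq a 0.
    have [q qE] := rep b; exists 0, q; split=> //; last by rewrite linear0l.
    by move=> u; rewrite linear0l zero_lfunE.
  have [p pE] := rep a; have [q qE] := rep b.
  rewrite zero_lfunE in au.
  (* As L is isotropic, subtracting a vector of L does not change omega q on L. *)
  exists p, (q - (omega p q / a u) *: vsval u); split=> //.
    move=> w; rewrite linearBl linearZl /= qE.
    by rewrite (lL.2 _ _ (subvsP u) (subvsP w)) mulr0 subr0.
  by rewrite linearBr linearZr /= pE divfK ?subrr.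
exists (velocity n omega L (fun t => shear_flow omega p q t @: L)%VS).
have sub := shear_flow_subgroup pq.
split.
  exists (fun t => shear_flow omega p q t @: L)%VS; split=> //.
    by case: sub => -> _ _ _; exact: lim1g.
  apply: (shear_flow_smooth_curve lL eL pq) => t.
  by case: sub => _ _ sphi _; exact: lagrangian_limg.
exists (shear_flow omega p q); split=> // v w.
rewrite deriv0_eval; last by case: sub.
by rewrite deriv0_shear_flow omega_shear /symprod !pE !qE.
Qed.

Section Point.
Variables (D L : {vspace V}) (F : {vspace V} -> R).
Hypotheses (LD : Ereg n omega D L) (dD : \dim D = n)
  (FD : defining_function n omega D L F).

Lemma dim_regular_orthov : \dim (L :&: orthov omega D) = 1%N.
Proof.
by have [[lL _] _] := LD; rewrite (dim_cap_orthov omega_sympl dimV lL dD) (dim_regular LD).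
Qed.

(** For the velocity of a flow with generator [A], [velocity_defining_function]
    gives [omega w (A v)], and the form [g] attached to this velocity is
    [omega (A v) w]: the covector form is minus the evaluation at [v] and [w]. *)
Lemma covector_form_regular (v w : subvs_of L) :
  (L :&: D = <[vsval v]>)%VS -> (L :&: orthov omega D = <[vsval w]>)%VS ->
  exists2 c : R, c != 0 & forall a b : dual L,
    covector_form n omega (differential F) a b = c * vecprod v w a b.
Proof.
move=> lv lw; have [[lL _] _] := LD; have [e0 eL] := exists_frame lL.1.
have [v1 [w1 [v1l v10 w1l w10 dF]]] := velocity_defining_function omega_sympl dimV LD dD FD eL.
move: v1l w1l; rewrite lv lw => /vlineP[x v1E] /vlineP[y w1E].
exists (- (x * y)).
  rewrite oppr_eq0 mulf_neq0 //.
    by apply: contraNneq v10 => x0; rewrite v1E x0 scale0r.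
  by apply: contraNneq w10 => y0; rewrite w1E y0 scale0r.
move=> a b; rewrite /covector_form; case: xgetP => [X _ [tX [phi [sub VX gX]]]|nX].
  rewrite /differential -VX.
  have [e00 de nL De] := flow_curve lL eL sub.
  rewrite (dF _ _ _ e00 de nL De) omegaC v1E w1E.
  have -> : deriv0 phi (x *: vsval v) = x *: deriv0 phi (vsval v) by rewrite linearZ.
  rewrite linearZl linearZr /=.
  have -> : omega (deriv0 phi (vsval v)) (vsval w) = vecprod v w a b.
    rewrite -deriv0_eval; last by case: sub.
    rewrite -gX /vecprod /symprod; congr (_ * _); congr (_ + _).
    by rewrite mulrC.
  by rewrite mulrA mulNr.
by have [X XE] := exists_tangent_form a b lL; case: (nX X).
Qed.

Lemma conformal_metric_regular (v w : subvs_of L) :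
  (L :&: D = <[vsval v]>)%VS -> (L :&: orthov omega D = <[vsval w]>)%VS ->
  conformal_metric n omega F L = conformal_class (vecprod v w).
Proof.
move=> lv lw; have [c c0 cE] := covector_form_regular lv lw.
apply/seteqP; split=> h [x x0 hE].
  by exists (x * c); [exact: mulf_neq0|move=> a b; rewrite hE cE mulrA].
exists (x / c); first by rewrite mulf_neq0 ?invr_eq0.
by move=> a b; rewrite hE cE mulrA divfK.
Qed.

Lemma decomposable_regular : decomposable (conformal_metric n omega F L).
Proof.
have sub1 U : \dim (L :&: U) = 1%N -> exists2 u : subvs_of L, u != 0 & (L :&: U = <[vsval u]>)%VS.
  move=> dU; pose u := vpick (L :&: U)%VS.
  have u0 : u != 0 by rewrite vpick0 -dimv_eq0 dU.
  have uLU : u \in (L :&: U)%VS by exact: memv_pick.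
  have uL : u \in L by move: uLU; rewrite memv_cap => /andP[].
  exists (vsproj L u); last by rewrite vsprojK //; exact: line_of.
  by apply: contraNneq u0 => p0; rewrite -(vsprojK uL) p0 linear0.
have [v v0 vE] := sub1 D (dim_regular LD).
have [w w0 wE] := sub1 _ dim_regular_orthov.
by exists v, w; split=> //; exact: conformal_metric_regular.
Qed.

(** If neither line lies in [H], the flow of the shear of [p] with itself, where
    [omega p] has kernel [H] on [L], fixes [H] pointwise and moves [L] with
    [dF = - omega p v * omega p w], which is nonzero. Conversely along a curve of
    planes containing [H] the form [omega u (A u')] on [L] is symmetric and vanishes
    when [u] lies in [H], hence also when [u'] does. *)
Lemma characteristic_regular H : hyperplane L H ->
  (characteristic n omega F L H <->
   (L :&: D <= H)%VS \/ (L :&: orthov omega D <= H)%VS).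
Proof.
move=> hH; have [HL _] := hH; have [[lL _] _] := LD; split.
  move=> [_ cH].
  have [p pE] := exists_hyperplane_form lL hH.
  have [e0 eL] := exists_frame lL.1.
  have [v [w [vl v0 wl w0 dF]]] := velocity_defining_function omega_sympl dimV LD dD FD eL.
  have vL : v \in L by move: vl; rewrite memv_cap => /andP[].
  have wL : w \in L by move: wl; rewrite memv_cap => /andP[].
  rewrite (line_of (dim_regular LD) vl v0) (line_of dim_regular_orthov wl w0) -!memvE.
  have pp := omega_alt omega p.
  have sub := shear_flow_subgroup pp.
  have tX : tangent_space n omega (prolongation n omega H) L
      (velocity n omega L (fun t => shear_flow omega p p t @: L)%VS).
    exists (fun t => shear_flow omega p p t @: L)%VS; split=> //.
      by case: sub => -> _ _ _; exact: lim1g.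
    apply: (shear_flow_smooth_curve lL eL pp) => t; split.
      by case: sub => _ _ sphi _; exact: lagrangian_limg.
    apply/subvP => h hH'; have hL := subvP HL h hH'.
    have := memv_img (shear_flow omega p p t) hL.
    have /eqP ph : omega p h == 0 by rewrite pE.
    by rewrite shear_flowE lfunE /= /shear_fun ph !scale0r addr0 !scaler0 addr0.
  have := cH _ tX; rewrite /differential.
  have [e00 de nL De] := flow_curve lL eL sub.
  rewrite (dF _ _ _ e00 de nL De) deriv0_shear_flow omegaC omega_shear /symprod.
  move/eqP; rewrite oppr_eq0 mulf_eq0 invr_eq0 pnatr_eq0 /= -mulr2n mulrn_eq0 /=.
  by rewrite mulf_eq0 !pE // => /orP[]; [left|right].
move=> lH; split=> // _ [gamma [g0 [e se nE] ->]].
have de := smooth_at_derivable se.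
have [ge0 _ _] := nbhs_singleton nE.
have eL : <<codom (e 0%R)>>%VS = L by rewrite -ge0.
have [A eA] := exists_hom_frame (deriv0 e) (frame_free lL.1 eL).
have [v [w [vl v0 wl w0 dF]]] := velocity_defining_function omega_sympl dimV LD dD FD eL.
have vL : v \in L by move: vl; rewrite memv_cap => /andP[].
have wL : w \in L by move: wl; rewrite memv_cap => /andP[].
have nE1 : \forall t \near (0 : R), gamma t = <<codom (e t)>>%VS /\ lagrangian n omega (gamma t).
  by apply: filterS nE => t [].
rewrite /differential (dF gamma e A erefl de nE1 eA).
have fixH h : h \in H -> {in L, forall u, omega h (A u) = 0}.
  move=> hH'; rewrite -eL; apply: (fixed_vector_orthogonal (n := n) de eA).
  by apply: filterS nE => t [-> lt [_ /subvP/(_ h hH')]].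
have symL : {in L &, forall u u', omega u (A u') = omega u' (A u)}.
  rewrite -eL; apply: (lagrangian_curve_symmetric de eA).
  by apply: filterS nE => t [-> lt _].
case: lH => [/subvP/(_ v vl) vH|/subvP/(_ w wl) wH].
  by rewrite symL // fixH.
exact: fixH.
Qed.

End Point.
End Hypersurface.

Theorem theorem3p30 (R : realType) (n : nat) (V : vectType R)
    (omega : {skew_symmetric V}) (D : {vspace V}) :
  (0 < n)%N ->
  is_psymplectic omega ->
  \dim {:V} = (2 * n)%N ->
  \dim D = n ->
  let D' := orthov omega D in
  [/\ forall L : {vspace V}, Ereg n omega D L ->
        let l := (L :&: D)%VS in
        let l' := (L :&: D')%VS in
        [/\ \dim l = 1%N, \dim l' = 1%N &
          forall F : {vspace V} -> R, defining_function n omega D L F ->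
          [/\ forall H, hyperplane L H ->
                (characteristic n omega F L H <-> (l <= H)%VS \/ (l' <= H)%VS),
              l <> l' ->
                exists H H' : 'rV[R]_(n - 2).+1 -> {vspace V},
                [/\ parametric_family L H /\
                    H @` [set t | t != 0] = characteristic_family n omega F L l,
                    parametric_family L H' /\
                    H' @` [set t | t != 0] = characteristic_family n omega F L l',
                    [set` l] = \bigcap_(t in [set t | t != 0]) [set` H t] &
                    [set` l'] = \bigcap_(t in [set t | t != 0]) [set` H' t]],
              l = l' ->
                characteristic_family n omega F L l =
                characteristic_family n omega F L l',
              decomposable (conformal_metric n omega F L) &
              forall v w : subvs_of L,
                l = <[vsval v]>%VS -> l' = <[vsval w]>%VS ->
                conformal_metric n omega F L = conformal_class (vecprod v w)]],
      forall l : {vspace V}, \dim l = 1%N -> (l <= D)%VS ->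
        exists2 L : {vspace V}, Ereg n omega D L & l = (L :&: D)%VS,
      [set` D] = \bigcup_(L in Ereg n omega D) [set` (L :&: D)%VS] &
      [set` D'] = \bigcup_(L in Ereg n omega D) [set` (L :&: D')%VS]].
Proof.
case: n => [//|m] _ sp dimV dD D'.
have dD' : \dim D' = m.+1 := dim_orthov_half sp dimV dD.
have ereg B : \dim B = m.+1 -> forall L, Ereg m.+1 omega B L <->
    lagrangian m.+1 omega L /\ \dim (L :&: B) = 1%N.
  move=> dB L; split=> [LB|[lL LB]].
    by split; [case: LB => -[]|exact: dim_regular LB].
  by split; [split=> //; rewrite -dimv_eq0 LB|rewrite LB].
have union B : \dim B = m.+1 ->
    [set` B] = \bigcup_(L in Ereg m.+1 omega B) [set` (L :&: B)%VS].
  move=> dB; apply/seteqP; split=> [v /= vB|v [L _] /=]; last first.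
    by rewrite memv_cap => /andP[].
  have [u [u0 uB vu]] : exists u, [/\ u != 0, u \in B & v \in <[u]>%VS].
    have [v0|v0] := eqVneq v 0; last by exists v; rewrite memv_line.
    exists (vpick B); rewrite memv_pick vpick0 -dimv_eq0 dB v0; split=> //.
    exact: mem0v.
  have [||L LB lE] := @exists_lagrangian_cap _ _ _ _ sp dimV B <[u]>%VS dB.
  - by rewrite dim_vline u0.
  - by rewrite -memvE.
  by exists L => //=; rewrite -lE.
split; last 2 first.
- exact: union.
- (* The planes that are regular for D' are those that are regular for D. *)
  rewrite (union D' dD'); congr (\bigcup_(L in _) _).
  apply/seteqP; split=> L LB.
    have [lL LB1] := (ereg _ dD' L).1 LB; apply/(ereg _ dD); split=> //.
    by rewrite -(dim_cap_orthov sp dimV lL dD).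
  have [lL LB1] := (ereg _ dD L).1 LB; apply/(ereg _ dD'); split=> //.
  by rewrite (dim_cap_orthov sp dimV lL dD).
- move=> L LD l l'.
  have dl : \dim l = 1%N := dim_regular LD.
  have dl' : \dim l' = 1%N := dim_regular_orthov sp dimV LD dD.
  split=> // F FD.
  have charE := characteristic_regular sp dimV LD dD FD.
  split.
  + exact: charE.
  + move=> ll'.
    (* In dimension n = 1 both lines are equal to L. *)
    have [k kE] : exists k, m = k.+1.
      have [[[dL _] _] _] := LD; exists m.-1; rewrite prednK // lt0n.
      apply/eqP => m0; case: ll'; rewrite m0 in dL.
      have -> : l = L by apply/eqP; rewrite eqEdim capvSl dl dL.
      by apply/esym/eqP; rewrite eqEdim capvSl dl' dL.
    have -> : (m.+1 - 2 = k)%N by rewrite kE !subSS subn0.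
    have kn : k.+2 = m.+1 by rewrite kE.
    have [||H [pH HE lH]] := exists_characteristic_family (F := F) sp dimV LD.1.1 kn dl.
    * exact: capvSl.
    * by move=> H hH lH; apply/charE => //; left.
    have [||H' [pH' HE' lH']] := exists_characteristic_family (F := F) sp dimV LD.1.1 kn dl'.
    * exact: capvSl.
    * by move=> H' hH' lH'; apply/charE => //; right.
    by exists H, H'; split=> //; split.
  + by move=> ->.
  + exact: (decomposable_regular sp dimV LD dD FD).
  + exact: (conformal_metric_regular sp dimV LD dD FD).
- move=> l dl lD; exact: exists_lagrangian_cap.
Qed.
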